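(* If there is a ladder system on a stationary subset of $\omega_1$ which satisfies monochromatic uniformization for $\omega$ colours, then there is an abelian group of cardinality $\aleph_1$ which is hereditarily separable and not free.
   Context: A group $G$ is separable if every finite rank pure subgroup of $G$ is a free direct summand of $G$; $G$ is hereditarily separable if every subgroup of $G$ is separable. For $S\subseteq\lim(\omega_1)$, a ladder on $\delta\in S$ is a strictly increasing $\eta_\delta\colon\omega\to\delta$ with range cofinal in $\delta$; a ladder system on $S$ is a family $\eta=\{\eta_\delta:\delta\in S\}$ of ladders. $\eta$ satisfies monochromatic uniformization for $\omega$ colours if for every $c\colon S\to\omega$ there are $f\colon\omega_1\to\omega$ and $f^*\colon S\to\omega$ with $f(\eta_\delta(n))=c(\delta)$ for all $\delta\in S$ and $n\ge f^*(\delta)$. *)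

(* Defs.v *)
From HB Require Import structures.
From mathcomp Require Import all_boot all_order all_algebra.
From mathcomp Require Import all_classical wochoice.

Set Implicit Arguments.
Unset Strict Implicit.
Unset Printing Implicit Defensive.

Import Order.TTheory GRing.Theory.

Local Open Scope classical_set_scope.
Local Open Scope ring_scope.

Section AbelianGroups.
Variable G : zmodType.
Implicit Types (A B H K : set G).

(* A subgroup is a set in the ambient group G. The predicates below apply to a
   subgroup A regarded as a group in its own right; G itself is [set: G]. *)
Definition subgroup A := zmod_closed [in A].

Definition Zindependent B :=
  forall (s : seq G) (a : G -> int), uniq s -> [set` s] `<=` B ->
    \sum_(b <- s) b *~ a b = 0 -> {in s, forall b, a b = 0}.

Definition Zspan B : set G :=
  [set x | exists (s : seq G) (a : G -> int),
     [set` s] `<=` B /\ x = \sum_(b <- s) b *~ a b].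

Definition Zbasis A B := [/\ B `<=` A, Zindependent B & A `<=` Zspan B].

Definition free_abelian A := exists B, Zbasis A B.

Definition maximal_independent A B :=
  [/\ B `<=` A, Zindependent B &
      forall C, C `<=` A -> Zindependent C -> B `<=` C -> C = B].

(* Torsion-free rank: torsion elements do not contribute. A torsion subgroup
   then has rank 0, so that separable groups are torsion-free. *)
Definition finite_rank A :=
  exists B, finite_set B /\ maximal_independent A B.

Definition pure_in A H :=
  forall (n : nat) x, A x -> H (x *+ n) -> exists2 y, H y & x *+ n = y *+ n.

Definition direct_summand A H :=
  exists K, [/\ subgroup K, K `<=` A, H `&` K = [set 0] &
    forall x, A x -> exists h k, [/\ H h, K k & x = h + k]].

Definition separable_group A :=
  forall H, subgroup H -> H `<=` A -> pure_in A H -> finite_rank H ->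
    free_abelian H /\ direct_summand A H.

Definition hereditarily_separable A :=
  forall B, subgroup B -> B `<=` A -> separable_group B.

End AbelianGroups.

Local Open Scope order_scope.

(* Characterizes omega_1 up to isomorphism; countable includes finite. *)
Definition is_omega1 (d : Order.disp_t) (W : orderType d) :=
  [/\ well_order (<=%O : rel W),
      ~ countable [set: W] &
      forall a : W, countable [set b | b < a]].

Section Ladders.
Variables (d : Order.disp_t) (W : orderType d).
Implicit Types (S C : set W) (eta : W -> nat -> W).

Definition limits : set W :=
  [set delta | (exists a, a < delta) /\
     forall a, a < delta -> exists b, a < b < delta].

Definition unbounded C := forall a, exists2 b, C b & a < b.

Definition closed_in_order C :=
  forall delta, limits delta ->
    (forall a, a < delta -> exists2 b, C b & a < b < delta) -> C delta.

Definition club C := closed_in_order C /\ unbounded C.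

Definition stationary S := forall C, club C -> S `&` C !=set0.

Definition ladder (delta : W) (e : nat -> W) :=
  [/\ forall n, e n < delta,
      {homo e : m n / (m < n)%N >-> m < n} &
      forall a, a < delta -> exists n, a <= e n].

(* The values of eta off S are irrelevant, as are those of c and fstar below. *)
Definition ladder_system S eta :=
  S `<=` limits /\ forall delta, S delta -> ladder delta (eta delta).

Definition monochromatic_uniformization S eta :=
  forall c : W -> nat, exists (f : W -> nat) (fstar : W -> nat),
    forall delta n, S delta -> (fstar delta <= n)%N ->
      f (eta delta n) = c delta.

End Ladders.

Lemma nat_bool_uncountable : ~ countable [set: nat -> bool].
Proof.
move=> /countable_injP[f f_inj].
pose D n := `[< exists2 x : nat -> bool, f x = n & ~~ x n >].
have: D (f D) = ~~ D (f D) by apply/asboolP/idP => [[x /f_inj ->//]|nD];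
  [rewrite inE|rewrite inE|exists D].
by case: (D _).
Qed.

(* The predicate is_omega1 is satisfiable. *)
Lemma omega1_exists :
  exists (d : Order.disp_t) (W : orderType d), is_omega1 W.
Proof.
have [R Rwo] := well_ordering_principle (nat -> bool).
have Rmin (A : set (nat -> bool)) : A !=set0 ->
    exists2 z, A z & forall x, A x -> R z x.
  move=> [x Ax]; have [|z [[Az lbz] _]] := Rwo [in A].
    by exists x; rewrite !inE.
  exists z; first by move: Az; rewrite !inE.
  by move=> y Ay; apply: lbz; rewrite !inE.
have Rtot : total R.
  move=> x y; have [|z] := Rmin [set x; y]; first by exists x; left.
  by move=> [] -> zR; rewrite zR ?orbT //; [right|left].
have Ranti : antisymmetric R.
  move=> x y /andP[Rxy Ryx].
  have Rr u : R u u by have := Rtot u u; rewrite orbb.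
  have [|z [_ zu]] := Rwo [in [set x; y]]; first by exists x; rewrite !inE; left.
  rewrite -(zu x) ?(zu y) //; split; rewrite ?inE; [by right| |by left|];
    by move=> u; rewrite !inE => -[->|->].
have Rtr : transitive R.
  move=> y x z Rxy Ryz; have [|t] := Rmin [set x; y; z].
    by exists x; left; left.
  move=> [[->|->]|->] tR.
  - by apply: tR; right.
  - by rewrite (Ranti x y) // Rxy tR //; left; left.
  - by rewrite -(Ranti y z) // Ryz tR //; left; right.
pose I x := [set y | R y x && (y != x)].
pose A : set (nat -> bool) := [set x | countable (I x)].
have Aunc : ~ countable A.
  move=> cA; have [AT|/set0P/Rmin[z nAz zmin]] := eqVneq (~` A) set0.
    by apply: nat_bool_uncountable; rewrite -setC0 -AT setCK.
  apply: nAz; apply: sub_countable cA; apply: subset_card_le => y /andP[Ryz yz].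
  apply: contrapT => /zmin Rzy; move: yz.
  by rewrite (Ranti y z) ?eqxx // Ryz Rzy.
pose T := {x | x \in A}.
pose le (u v : T) := R (val u) (val v).
have le_refl : reflexive le by move=> u; have := Rtot (val u) (val u); rewrite orbb.
have le_anti : antisymmetric le by move=> u v /Ranti/val_inj.
have le_tr : transitive le by move=> u v w; exact: Rtr.
have le_tot : total le by move=> u v; exact: Rtot.
pose d := Order.Disp tt tt.
pose P : porderType d :=
  HB.pack_for (porderType d) T (Order.Le_isPOrder.Build d T le_refl le_anti le_tr).
pose W : orderType d :=
  HB.pack_for (orderType d) T (Order.POrder.class P)
    (Order.POrder_isTotal.Build d P le_tot).
exists d, W; split.
- apply: antisymmetric_well_order => [|B [u Bu]]; first exact: le_anti.
  have [|z [v Bv <-] vmin] := Rmin [set val w | w in [set w : T | w \in B]].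
    by exists (val u), u.
  by exists v; split=> // w Bw; apply: vmin; exists w.
- move=> cT; apply: Aunc.
  have -> : A = [set val u | u in [set: T]].
    apply/seteqP; split=> [x Ax|_ [[x xA] _ <-]]; last exact: set_mem.
    by exists (exist _ x (mem_set Ax)).
  exact: sub_countable (card_image_le _ _) cT.
- move=> a; have: countable (I (val a)) by have := valP a; rewrite inE.
  apply: sub_countable.
  rewrite -(card_le_eql (inj_card_eq (f := val) _)).
    apply: subset_card_le => _ [b + <-]; rewrite /= lt_neqAle => /andP[ba ab].
    by apply/andP; split.
  by move=> x y _ _; exact: val_inj.
Qed.

(* Main.v *)
Require Import Defs.
From HB Require Import structures.
From mathcomp Require Import all_boot all_order all_algebra.
From mathcomp Require Import all_classical.
From mathcomp Require Import ring.

(** Index a free Q-basis by the finite sequences s in omega_1 (vectors x_s) and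
    by the points delta of S (vectors y_delta), and let G be the group generated
    by all x_s, all y_delta and all (y_delta - x_s) / q, where q is prime and s is
    the initial segment of length q of the ladder on delta.

    G is not free: modulo the part of G living below delta, y_delta is divisible by
    every prime, and this happens for stationarily many delta.

    G is hereditarily separable once, for every prime p, each homomorphism psi from
    G to Z[1/p]/Z lifts to Z[1/p]. Indeed, if b lies in a subgroup B but not in pB,
    then k b + p x |-> k/p extends to such a psi by divisibility, and p times a lift
    is a functional on B with integral values and value prime to p at b. Hence a
    pure b takes the value 1 under some functional B -> Z, and finite rank pure
    subgroups split off one generator at a time.

    To lift psi, the relation for the prime p prescribes the value at y_delta modulo
    p; this class is the colour of delta. Values are assigned to the nodes s by
    recursion on length, following a guess for the value at the limit. When the
    colour read at a node contradicts the guess modulo p, the Chinese remainder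
    theorem supplies a new guess with that colour which is still congruent modulo q
    to the value already assigned at length q, for every prime q <> p met so far. By
    uniformization the colours along the ladder of delta are eventually correct, so
    the guess stabilizes and its limit satisfies every relation. *)

Set Implicit Arguments.
Unset Strict Implicit.
Unset Printing Implicit Defensive.

Import Order.TTheory GRing.Theory Num.Theory.

Local Open Scope classical_set_scope.
Local Open Scope card_scope.
Local Open Scope ring_scope.

(** * Subgroups and integral spans *)

Section Subgroups.
Variable G : zmodType.
Implicit Types (A B H K : set G).

Lemma subgroupP A :
  subgroup A <-> A 0 /\ (forall x y, A x -> A y -> A (x - y)).
Proof.
split=> [[A0 AB]|[A0 AB]]; split; first exact: set_mem A0.
- by move=> x y Ax Ay; apply/set_mem/AB; apply/mem_set.
- exact: mem_set.
- by move=> x y /set_mem Ax /set_mem Ay; apply/mem_set/AB.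
Qed.

Lemma subgroup0 A : subgroup A -> A 0.
Proof. by move/subgroupP => []. Qed.

Lemma subgroupB A x y : subgroup A -> A x -> A y -> A (x - y).
Proof. by move/subgroupP => [_]; apply. Qed.

Lemma subgroupN A x : subgroup A -> A x -> A (- x).
Proof. by move=> sA Ax; rewrite -sub0r; apply: subgroupB => //; exact: subgroup0. Qed.

Lemma subgroupD A x y : subgroup A -> A x -> A y -> A (x + y).
Proof. by move=> sA Ax Ay; rewrite -[y]opprK; apply: subgroupB => //; exact: subgroupN. Qed.

Lemma subgroupMn A x n : subgroup A -> A x -> A (x *+ n).
Proof.
move=> sA Ax; elim: n => [|n IH]; first by rewrite mulr0n; exact: subgroup0.
by rewrite mulrS; exact: subgroupD.
Qed.

Lemma subgroupMz A x k : subgroup A -> A x -> A (x *~ k).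
Proof.
move=> sA Ax; case: k => n; first by rewrite -pmulrn; exact: subgroupMn.
by rewrite NegzE mulrNz -pmulrn; apply: subgroupN => //; exact: subgroupMn.
Qed.

Lemma subgroup_sum A (I : eqType) (s : seq I) (F : I -> G) :
  subgroup A -> (forall i, i \in s -> A (F i)) -> A (\sum_(i <- s) F i).
Proof.
move=> sA AF; rewrite big_seq; elim/big_ind: _ => //; first exact: subgroup0.
by move=> x y; exact: subgroupD.
Qed.

Lemma Zsum_widen (s t : seq G) (a : G -> int) :
  uniq s -> uniq t -> {subset s <= t} -> (forall b, b \notin s -> a b = 0) ->
  \sum_(b <- s) b *~ a b = \sum_(b <- t) b *~ a b.
Proof.
move=> us ut st a0; rewrite [RHS](bigID [in s]) /= [X in _ + X]big1 ?addr0.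
  rewrite -[RHS]big_filter; apply: perm_big; apply: uniq_perm => //.
    exact: filter_uniq.
  by move=> b; rewrite mem_filter; case: (boolP (b \in s)) => // /st ->.
by move=> b bs; rewrite a0 ?mulr0z.
Qed.

(** Repeated vectors are merged by multiplying each coefficient by the multiplicity of its
    vector. *)
Lemma ZspanP B x : Zspan B x <->
  exists (s : seq G) (a : G -> int), [/\ uniq s, [set` s] `<=` B,
    (forall b, b \notin s -> a b = 0) & x = \sum_(b <- s) b *~ a b].
Proof.
split=> [[s [a [sB ->]]]|[s [a [_ sB _ ->]]]]; last by exists s, a.
exists (undup s), (fun b => a b * (count_mem b s)%:Z); split.
- exact: undup_uniq.
- by move=> b /=; rewrite mem_undup; exact: sB.
- by move=> b; rewrite mem_undup => /count_memPn ->; rewrite mulr0.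
rewrite -big_undup_iterop_count; apply: eq_bigr => b _.
by rewrite mulrzA -pmulrn.
Qed.

Lemma sub_Zspan B : B `<=` Zspan B.
Proof.
move=> b Bb; exists [:: b], (fun=> 1); split; last by rewrite big_seq1 mulr1z.
by move=> c /=; rewrite inE => /eqP ->.
Qed.

Lemma subgroup_Zspan B : subgroup (Zspan B).
Proof.
apply/subgroupP; split; first by exists [::], (fun=> 0); rewrite big_nil.
move=> _ _ /ZspanP[s [a [us sB a0 ->]]] /ZspanP[t [c [ut tB c0 ->]]].
pose u := undup (s ++ t); exists u, (fun b => a b - c b); split.
  by move=> b; rewrite /= mem_undup mem_cat => /orP[/sB|/tB].
have uu : uniq u by exact: undup_uniq.
rewrite (Zsum_widen us uu) // ?(Zsum_widen ut uu) //.
- by rewrite -sumrB; apply: eq_bigr => b _; rewrite mulrzBr.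
- by move=> b bt; rewrite mem_undup mem_cat bt orbT.
- by move=> b bs; rewrite mem_undup mem_cat bs.
Qed.

Lemma Zspan_min B K : subgroup K -> B `<=` K -> Zspan B `<=` K.
Proof.
move=> sK BK _ [s [a [sB ->]]]; apply: subgroup_sum => // b bs.
by apply: subgroupMz => //; exact/BK/sB.
Qed.

Lemma Zspan_mono B C : B `<=` C -> Zspan B `<=` Zspan C.
Proof.
by move=> BC; apply: Zspan_min; [exact: subgroup_Zspan|apply: subset_trans BC _; exact: sub_Zspan].
Qed.

Lemma countable_Zspan B : countable B -> countable (Zspan B).
Proof.
move=> /countable_injP[f f_inj].
pose g n := xget 0 [set b | B b /\ f b = n].
have gf b : B b -> g (f b) = b.
  move=> Bb; rewrite /g; case: xgetP => [c _ [Bc fc]|/(_ b)[]//].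
  by apply: f_inj; rewrite ?inE.
pose F (l : seq (nat * int)) := \sum_(i <- l) g i.1 *~ i.2.
apply: (@sub_countable _ _ _ [set F l | l in setT]).
  apply: subset_card_le => _ [s [a [sB ->]]]; exists [seq (f b, a b) | b <- s] => //.
  by rewrite /F big_map big_seq [RHS]big_seq; apply: eq_bigr => b /sB /gf /= ->.
by apply: sub_countable (card_image_le _ _) _; exact: countableP.
Qed.

End Subgroups.

Lemma int_subgroup_principal (A : set int) : subgroup A ->
  exists d : nat, forall k, A k <-> (d%:Z %| k)%Z.
Proof.
move=> sA; have [[k Ak k0]|nA] := pselect (exists2 k, A k & k != 0); last first.
  exists 0%N => k; split=> [Ak|]; last by rewrite dvd0z => /eqP ->; exact: subgroup0.
  by rewrite dvd0z; apply: contrapT => /negP k0; apply: nA; exists k.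
have ex : exists n : nat, (0 < n)%N && `[< A n%:Z >].
  exists `|k|%N; rewrite absz_gt0 k0; apply/asboolP.
  by rewrite abszE; case: (ger0P k) => // _; exact: subgroupN.
case: (ex_minnP ex) => d /andP[d0 /asboolP Ad] dmin.
have Adm i : (d%:Z %| i)%Z -> A i.
  by move=> /dvdzP[q ->]; rewrite mulrC -mulrzz; exact: subgroupMz.
exists d => i; split=> [Ai|]; last exact: Adm.
apply/dvdz_mod0P.
have Am : A (i %% d)%Z.
  rewrite /modz; apply: subgroupB => //; apply: Adm; exact: dvdz_mull.
have m0 : 0 <= (i %% d)%Z by apply: modz_ge0; rewrite -lt0n.
have md : (i %% d)%Z < d%:Z by apply: ltz_pmod; rewrite ltz_nat.
case: (i %% d)%Z Am m0 md => // n An _; rewrite ltz_nat => nd.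
case: n => // n in An nd *.
by have := dmin n.+1 (introT (asboolP _) An); rewrite leqNgt nd.
Qed.

(** * Splitting off pure subgroups of finite rank *)

Section SeparabilityCriterion.
Variable G : zmodType.
Implicit Types (A B H K : set G) (h x : G).

Hypothesis enough_functionals : forall h, h != 0 ->
  exists2 u : {additive G -> rat}, (forall x, u x \is a Num.int) & u h != 0.

Hypothesis unit_functional : forall B b, subgroup B -> B b ->
  (forall p x, prime p -> B x -> b != x *+ p) ->
  exists2 u : {additive G -> rat}, (forall x, B x -> u x \is a Num.int) & u b = 1.

Lemma mulrz_eq0_torsionfree h k : (h *~ k == 0) = (h == 0) || (k == 0).
Proof.
case: (eqVneq h 0) => [->|h0]; first by rewrite mul0rz eqxx.
case: (eqVneq k 0) => [->|k0]; first by rewrite mulr0z eqxx.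
have [u _ uh] := enough_functionals h0; apply/negP => /eqP hk.
have := raddfMz u k h; rewrite hk raddf0 => /esym/eqP.
by rewrite mulrz_eq0 (negPf k0) (negPf uh).
Qed.

(** Among the elements of [H] not killed by [u], one of least absolute value works: a [p]-th part of
    it would have a smaller nonzero value. *)
Lemma exists_prime_free H h : subgroup H -> H h -> h != 0 ->
  exists2 g, H g /\ g != 0 & forall p x, prime p -> H x -> g != x *+ p.
Proof.
move=> sH Hh h0; have [u uZ uh] := enough_functionals h0.
have ex : exists n, `[< exists g, [/\ H g, u g != 0 & `|u g| = n%:R] >].
  have /natrP[n nE] := natr_norm_int (uZ h).
  by exists n; apply/asboolP; exists h.
case: (ex_minnP ex) => n /asboolP[g [Hg ug gn]] nmin.
exists g; first by split=> //; apply: contraNneq ug => ->; rewrite raddf0.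
move=> p x pp Hx; apply/eqP => gE.
have ux : u x != 0 by apply: contraNneq ug; rewrite gE raddfMn => ->; rewrite mul0rn.
have /natrP[m mE] := natr_norm_int (uZ x).
have /nmin : `[< exists g, [/\ H g, u g != 0 & `|u g| = m%:R] >].
  by apply/asboolP; exists x.
move: gn; rewrite gE raddfMn normrMn mE -mulrnA => /eqP; rewrite eqr_nat => /eqP <-.
rewrite leqNgt ltn_Pmulr ?prime_gt1 // lt0n.
by apply: contraNneq ux => m0; rewrite -normr_eq0 mE m0.
Qed.

(** Finite rank in a form suited to induction: the length of [s] bounds the rank. *)
Definition virtually_spans (s : seq G) H :=
  forall h, H h -> exists2 k : int, k != 0 & Zspan [set` s] (h *~ k).

(* Projecting along h makes the vectors of s dependent, so one can be dropped. *)
Lemma virtually_spans_ker (u : {additive G -> rat}) s H h :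
  subgroup H -> H h -> u h = 1 -> (forall x, H x -> u x \is a Num.int) ->
  [set` s] `<=` H -> virtually_spans s H ->
  exists t, [/\ (size t < size s)%N, [set` t] `<=` H `&` [set x | u x = 0] &
    virtually_spans t (H `&` [set x | u x = 0])].
Proof.
move=> sH Hh uh uZ sS vs.
(* Projection along [h] to the kernel of [u]; on [H] the floor is the exact value of [u]. *)
pose pr x := x - h *~ Num.floor (u x).
have uE x : H x -> u (pr x) = 0.
  move=> Hx; rewrite /pr raddfB raddfMz uh /= -[X in X - _](floorK (uZ _ Hx)).
  by rewrite subrr.
have [k k0 /ZspanP[t [a [ut ts _ hk]]]] := vs _ Hh.
have h0 : h != 0 by apply: contra_eqN uh => /eqP ->; rewrite raddf0 eq_sym oner_eq0.
have [b0 b0t ab0] : exists2 b, b \in t & a b != 0.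
  apply: contrapT => nb; have /eqP : h *~ k = 0.
    rewrite hk big_seq big1 // => b bt; have [->|ab] := eqVneq (a b) 0.
      by rewrite mulr0z.
    by case: nb; exists b.
  by rewrite mulrz_eq0_torsionfree (negPf h0) (negPf k0).
have b0s := ts _ b0t.
pose r := map pr (rem b0 s).
have mem_r b : b \in s -> b != b0 -> Zspan [set` r] (pr b).
  move=> bs bb0; apply/sub_Zspan/map_f; move: bs.
  by rewrite (perm_mem (perm_to_rem b0s)) inE (negPf bb0).
have sr := subgroup_Zspan [set` r].
(* [L] is spanned by [r] and [h], and contains [a b0] times every vector of [s]; for elements killed
   by [u] the [h] component vanishes. *)
pose L := [set x | exists m, Zspan [set` r] (x - h *~ m)].
have sL : subgroup L.
  apply/subgroupP; split; first by exists 0; rewrite mulr0z subr0; exact: subgroup0.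
  move=> x y [m xm] [l yl]; exists (m - l).
  have -> : x - y - h *~ (m - l) = (x - h *~ m) - (y - h *~ l).
    by rewrite mulrzBr !opprD !opprK addrACA.
  exact: subgroupB.
have Lh : L h by exists 1; rewrite mulr1z subrr; exact: subgroup0.
have Lb b : b \in s -> b != b0 -> L b.
  by move=> bs bb0; exists (Num.floor (u b)); exact: mem_r.
have Lb0 : L (b0 *~ a b0).
  have -> : b0 *~ a b0 = h *~ k - \sum_(b <- rem b0 t) b *~ a b.
    by rewrite hk (perm_big _ (perm_to_rem b0t)) big_cons addrK.
  apply: subgroupB => //; first exact: subgroupMz.
  apply: subgroup_sum => // b; rewrite mem_rem_uniq // inE => /andP[bb0 bt].
  by apply: subgroupMz => //; apply: Lb => //; exact: ts.
have Ls x : Zspan [set` s] x -> L (x *~ a b0).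
  apply: (@Zspan_min _ _ [set x | L (x *~ a b0)]).
    apply/subgroupP; split; first by rewrite /= mul0rz; exact: subgroup0.
    by move=> y z Ly Lz; rewrite /= mulrzBl; exact: subgroupB.
  move=> b bs /=; have [->//|bb0] := eqVneq b b0.
  by apply: subgroupMz => //; exact: Lb.
have rH : [set` r] `<=` H `&` [set x | u x = 0].
  move=> _ /mapP[b /mem_rem /sS Hb ->]; split; last exact: uE.
  by apply: subgroupB => //; exact: subgroupMz.
exists r; split=> //.
  by rewrite size_map size_rem // prednK //; case: (s) b0s.
move=> x [Hx ux]; have [l l0 /Ls[m]] := vs _ Hx; rewrite -mulrzA => xm.
exists (l * a b0); first by rewrite mulf_neq0.
suff m0 : m = 0 by move: xm; rewrite m0 mulr0z subr0.
have su : subgroup [set x | u x = 0].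
  apply/subgroupP; split; first by rewrite /= raddf0.
  by move=> y z /= uy uz; rewrite raddfB uy uz subrr.
have /= := Zspan_min su (fun y ry => (rH y ry).2) xm.
rewrite raddfB !(raddfMz u) uh ux mul0rz sub0r => /eqP.
by rewrite oppr_eq0 intr_eq0 => /eqP.
Qed.

(** Applying [u] to a relation isolates the coefficient of [h]; the rest is a relation in [B]. *)
Lemma Zindependent_setU1 (u : {additive G -> rat}) h B :
  u h = 1 -> (forall b, B b -> u b = 0) -> Zindependent B ->
  Zindependent (h |` B).
Proof.
move=> uh uB iB s a us sB s0.
have nBh : ~ B h by move=> /uB /eqP; rewrite uh oner_eq0.
have sB' b : b \in s -> b != h -> B b.
  by move=> /sB [->|//]; rewrite eqxx.
have ah : h \in s -> a h = 0.
  move=> hs; have /eqP := congr1 u s0; rewrite raddf0 raddf_sum.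
  rewrite (bigD1_seq h) //= big_seq_cond big1 => [|b /andP[bs bh]].
    by rewrite addr0 raddfMz uh; rewrite intr_eq0 => /eqP.
  by rewrite raddfMz uB ?mul0rz //; exact: sB'.
move=> b bs; have [bE|bh] := eqVneq b h; first by rewrite bE; apply: ah; rewrite -bE.
apply: (iB (rem h s) a) => //.
- exact: rem_uniq.
- by move=> c /=; rewrite mem_rem_uniq // inE => /andP[ch cs]; exact: sB'.
- rewrite -[RHS]s0; case: (boolP (h \in s)) => hs; last by rewrite rem_id.
  by rewrite [RHS](perm_big _ (perm_to_rem hs)) big_cons ah //= mulr0z add0r.
- by rewrite mem_rem_uniq // inE bh.
Qed.

Lemma trivial_free_summand B H : subgroup B -> H = [set 0] ->
  free_abelian H /\ direct_summand B H.
Proof.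
move=> sB ->; split.
  exists set0; split=> // [t a _ ts _ b /ts []|_ ->].
  exact: (subgroup0 (subgroup_Zspan _)).
exists B; split=> //.
  by apply/seteqP; split=> [x []//|x ->]; split=> //; exact: subgroup0.
by move=> x Bx; exists 0, x; rewrite add0r.
Qed.

(** Since [u] is integral on [B] and [u h = 1], subtracting from x the multiple of [h] by [u x]
    splits both [B] and [H] into the multiples of [h] and the kernel of [u]. *)
Lemma ker_free_summand B H (u : {additive G -> rat}) h :
  subgroup B -> subgroup H -> H `<=` B ->
  H h -> u h = 1 -> (forall x, B x -> u x \is a Num.int) ->
  let Z := [set x | u x = 0] in
  free_abelian (H `&` Z) /\ direct_summand (B `&` Z) (H `&` Z) ->
  free_abelian H /\ direct_summand B H.
Proof.
move=> sB sH HB Hh uh uZ Z [[D [DH iD spD]] [K [sK KB HK BK]]].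
have split1 A x : A `<=` B -> subgroup A -> A h -> A x ->
    exists m, (A `&` Z) (x - h *~ m).
  move=> AB sA Ah Ax; exists (Num.floor (u x)); split.
    by apply: subgroupB => //; exact: subgroupMz.
  rewrite /Z /= raddfB raddfMz uh -[X in X - _](floorK (uZ _ (AB _ Ax))).
  by rewrite subrr.
split.
  exists (h |` D); split.
  - by move=> x [->//|/DH[]].
  - by apply: (@Zindependent_setU1 u) => // b /DH[].
  move=> x /(split1 H _ HB sH Hh)[m /spD xm]; rewrite -(subrK (h *~ m) x).
  have sD := subgroup_Zspan (h |` D); apply: subgroupD => //.
    by apply: Zspan_mono xm => y; right.
  by apply: subgroupMz => //; apply: sub_Zspan; left.
exists K; split=> //; first by move=> x /KB[].
  apply/seteqP; split=> [x [Hx Kx]|_ ->]; last by split; exact: subgroup0.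
  by rewrite -HK; split=> //; split=> //; have [] := KB _ Kx.
move=> x /(split1 B _ (@subset_refl _ B) sB (HB _ Hh))[m /BK[h' [k [[Hh' _] Kk xm]]]].
exists (h *~ m + h'), k; split=> //.
  by apply: subgroupD => //; exact: subgroupMz.
by rewrite -addrA -xm addrC subrK.
Qed.

(** Induction on the bound for the length of [s]: a unit functional at a prime-free [h] splits off
    its multiples, and the kernel needs a shorter list. *)
Lemma pure_virtually_spanned_summand n B H s :
  subgroup B -> subgroup H -> H `<=` B -> pure_in B H ->
  (size s <= n)%N -> [set` s] `<=` H -> virtually_spans s H ->
  free_abelian H /\ direct_summand B H.
Proof.
elim: n B H s => [|n IH] B H s sB sH HB pH sn sS vs.
  apply: trivial_free_summand => //; apply/seteqP; split=> [x /vs[k k0]|_ ->];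
    last exact: subgroup0.
  move: sn; rewrite leqn0 size_eq0 => /eqP -> [t [a [ts]]].
  rewrite big_seq big1 => [/eqP|b /ts //].
  by rewrite mulrz_eq0_torsionfree (negPf k0) orbF => /eqP.
have [[h0 Hh0 h00]|nH] := pselect (exists2 h, H h & h != 0); last first.
  apply: trivial_free_summand => //; apply/seteqP; split=> [x Hx|_ ->]; last exact: subgroup0.
  by apply: contrapT => /eqP x0; apply: nH; exists x.
have [h [Hh _] hp] := exists_prime_free sH Hh0 h00.
have [|u uZ uh] := @unit_functional B h sB (HB _ Hh).
  move=> p x pp Bx; apply/eqP => hx; have [|y Hy] := pH p x Bx; first by rewrite -hx.
  by rewrite -hx => /eqP; apply/negP; exact: hp.
have [t [ts tH vt]] := virtually_spans_ker sH Hh uh (fun x Hx => uZ x (HB x Hx)) sS vs.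
apply: (ker_free_summand sB sH HB Hh uh uZ).
have sZ : subgroup [set x | u x = 0].
  apply/subgroupP; split; first by rewrite /= raddf0.
  by move=> y z /= uy uz; rewrite raddfB uy uz subrr.
have sI A : subgroup A -> subgroup (A `&` [set x | u x = 0]).
  move=> sA; apply/subgroupP; split; first by split; exact: subgroup0.
  by move=> x y [Ax ux] [Ay uy]; split; exact: subgroupB.
apply: (IH _ _ t) => //; try exact: sI.
- by move=> x [Hx ux]; split=> //; exact: HB.
(* For multiplier 0 the equation says nothing about [u y], so [y] is taken to be 0. *)
- move=> [|m] x [Bx ux] [Hxm _]; first by exists 0; rewrite ?mulr0n //; exact: (subgroup0 (sI _ sH)).
  have [y Hy xy] := pH _ _ Bx Hxm; exists y => //; split=> //=.
  have /eqP := congr1 u xy; rewrite !raddfMn ux mul0rn eq_sym mulrn_eq0 /=.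
  by move=> /eqP.
- by rewrite -ltnS; exact: leq_trans sn.
Qed.

(** By maximality a vector [x] outside [s] enters a relation with [s]; its coefficient is nonzero
    because [s] is independent. *)
Lemma maximal_independent_virtually_spans H s :
  maximal_independent H [set` s] -> virtually_spans s H.
Proof.
move=> [sH is_ ms] x Hx.
have [xs|xs] := boolP (x \in s).
  by exists 1; rewrite // mulr1z; exact: sub_Zspan.
have : ~ Zindependent (x |` [set` s]).
  move=> i; have /seteqP[/(_ x) + _] : x |` [set` s] = [set` s].
    by apply: ms => // y [->|/sH].
  by rewrite /= (negPf xs) => /(_ (or_introl erefl)).
move=> /existsNP[t /existsNP[a]].
move=> /not_implyP[ut /not_implyP[tx /not_implyP[t0 nt]]].
have sum_rem : x *~ (if x \in t then a x else 0) + \sum_(b <- rem x t) b *~ a b = 0.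
  rewrite -[RHS]t0; case: (boolP (x \in t)) => xt.
    by rewrite [RHS](perm_big _ (perm_to_rem xt)) big_cons.
  by rewrite rem_id // mulr0z add0r.
have rs : [set` rem x t] `<=` [set` s].
  by move=> b /=; rewrite mem_rem_uniq // inE => /andP[bx /tx[/eqP|//]]; rewrite (negPf bx).
exists (if x \in t then a x else 0); last first.
  move/eqP: sum_rem; rewrite addr_eq0 => /eqP ->.
  apply: subgroupN; first exact: subgroup_Zspan.
  by exists (rem x t), a.
apply/eqP => ax0; apply: nt => b bt; have [bx|bx] := eqVneq b x.
  by move: ax0; rewrite -bx bt.
apply: (is_ (rem x t) a) => //; first exact: rem_uniq.
- by move: sum_rem; rewrite ax0 mulr0z add0r.
- by rewrite mem_rem_uniq // inE bx.
Qed.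

Lemma hereditarily_separable_criterion : hereditarily_separable [set: G].
Proof.
move=> B sB _ H sH HB pH [C [/finite_seqP[s ->] mC]].
apply: (@pure_virtually_spanned_summand (size s) _ _ s) => //.
  by case: mC.
exact: maximal_independent_virtually_spans.
Qed.

End SeparabilityCriterion.

(** * The rings Z[1/p] *)

Section LocalFractions.
Variable p : nat.
Hypothesis p_prime : prime p.

Let p0 : p%:R != 0 :> rat.
Proof. by rewrite pnatr_eq0 -lt0n prime_gt0. Qed.

Definition pfrac : set rat := [set r | exists k, r * p%:R ^+ k \is a Num.int].

Lemma int_pfrac r : r \is a Num.int -> pfrac r.
Proof. by move=> rZ; exists 0%N; rewrite expr0 mulr1. Qed.

Lemma pfracM r s : pfrac r -> pfrac s -> pfrac (r * s).
Proof. by move=> [k rk] [l sl]; exists (k + l)%N; rewrite exprD mulrACA rpredM. Qed.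

Lemma pfracB r s : pfrac r -> pfrac s -> pfrac (r - s).
Proof.
move=> [k rk] [l sl]; exists (k + l)%N.
rewrite exprD mulrBl {1}mulrA [p%:R ^+ k * _]mulrC mulrA.
by rewrite rpredB // rpredM // rpredX // natr_int.
Qed.

Lemma pfracN r : pfrac r -> pfrac (- r).
Proof. by move=> rP; rewrite -sub0r; apply: pfracB => //; exact/int_pfrac/int_num0. Qed.

Lemma pfracD r s : pfrac r -> pfrac s -> pfrac (r + s).
Proof. by move=> rP sP; rewrite -[s]opprK; apply: pfracB => //; exact: pfracN. Qed.

Lemma pfracV : pfrac p%:R^-1.
Proof. by exists 1%N; rewrite expr1 mulVf // int_num1. Qed.

Lemma rat_bezout (m n : nat) : coprime m n ->
  exists u v : rat, [/\ u \is a Num.int, v \is a Num.int & u * m%:R + v * n%:R = 1].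
Proof.
move=> mn; have [u [v uv]] := Bezoutz m n.
exists u%:~R, v%:~R; split; rewrite ?intr_int //.
have := congr1 (fun z : int => z%:~R : rat) uv.
by rewrite rmorphD /= !rmorphM /= => ->; rewrite /gcdz /= (eqP mn).
Qed.

(** Bezout for [q] and a power of [p] clearing the denominator of [r] expresses [r] through two
    integers. *)
Lemma pfrac_coprime_int q r : coprime q p -> pfrac r ->
  r * q%:R \is a Num.int -> r \is a Num.int.
Proof.
move=> qp [k rk] rq; have [u [v [uZ vZ uv]]] := rat_bezout (coprimeXr k qp).
have -> : r = u * (r * q%:R) + v * (r * p%:R ^+ k).
  by rewrite -[LHS]mulr1 -[X in _ * X = _]uv natrX; ring.
by apply: rpredD; apply: rpredM.
Qed.

(** Divisibility of Z[1/p]/Z: the [p]-part of [d] is a unit of Z[1/p], and the part prime to [p] is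
    inverted modulo a power of [p] that clears the denominator of [q]. *)
Lemma pfrac_div d q : (0 < d)%N -> pfrac q ->
  exists2 r, pfrac r & r * d%:R - q \is a Num.int.
Proof.
move=> d0 [j qj]; have [e pe dE] := pfactor_coprime p_prime d0.
have [u [v [uZ vZ uv]]] := rat_bezout (coprimeXr j (etrans (coprime_sym _ _) pe)).
set k := logn p d in dE.
exists (u * (q * p%:R ^+ j) / p%:R ^+ (j + k)).
  by exists (j + k)%N; rewrite mulfVK ?expf_neq0 //; exact: rpredM.
have -> : u * (q * p%:R ^+ j) / p%:R ^+ (j + k) * d%:R - q = - (v * (q * p%:R ^+ j)).
  rewrite dE natrM natrX exprD.
  have -> : u * (q * p%:R ^+ j) / (p%:R ^+ j * p%:R ^+ k) * (e%:R * p%:R ^+ k) = q * (u * e%:R).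
    by field; rewrite !expf_neq0.
  have -> : u * e%:R = 1 - v * p%:R ^+ j by apply/eqP; rewrite eq_sym subr_eq -natrX uv.
  by ring.
by rewrite rpredN rpredM.
Qed.

(** Induction on [n]: at a prime [n] other than [p], [c] is corrected by an integer multiple of [p]
    times the factorial of n - 1, which preserves the earlier congruences. *)
Lemma chinese_pfrac (v : nat -> rat) r n : pfrac r -> (forall i, pfrac (v i)) ->
  exists c, [/\ pfrac c, (c - r) / p%:R \is a Num.int &
    forall i, (i < n)%N -> prime i -> i != p -> pfrac ((c - v i) / i%:R)].
Proof.
move=> rP vP; elim: n => [|n [c [cP cr cv]]].
  by exists r; split; rewrite // subrr mul0r int_num0.
case: (boolP (prime n && (n != p))) => [/andP[n_prime np]|nn]; last first.
  exists c; split=> // i; rewrite ltnS leq_eqVlt => /predU1P[->|/cv//] ni nip.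
  by rewrite ni nip in nn.
have [k ck] := pfracB cP (vP n).
(* The factorial is prime to [n] by Wilson's theorem, so [u] below inverts this product modulo
   [n]. *)
have cop : coprime (p ^ k.+1 * n.-1`!) n.
  rewrite coprimeMl; apply/andP; split.
    by apply: coprimeXl; rewrite prime_coprime // dvdn_prime2 // eq_sym.
  rewrite coprime_sym prime_coprime //; apply/negP => dn.
  have := Wilson (prime_gt1 n_prime); rewrite n_prime => /esym.
  by rewrite -addn1 dvdn_addr // dvdn1 => /eqP n1; rewrite n1 in n_prime.
have [u [w [uZ wZ uw]]] := rat_bezout cop.
have n0 : n%:R != 0 :> rat by rewrite pnatr_eq0 -lt0n prime_gt0.
(* The power of [p] makes [a] an integer; the correction turns [c - v n] into
   [(c - v n) * w * n]. *)
pose a := (c - v n) * p%:R ^+ k.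
have step i : (i %| p * n.-1`!)%N -> prime i ->
    (a * u * (p * n.-1`!)%:R) / i%:R \is a Num.int.
  move=> /dvdnP[m ->] ip; rewrite natrM mulrA mulfK; last first.
    by rewrite pnatr_eq0 -lt0n prime_gt0.
  by apply: rpredM; [exact: rpredM|exact: natr_int].
exists (c - a * u * (p * n.-1`!)%:R); split.
- apply: pfracB => //; apply: int_pfrac.
  by apply: rpredM; [exact: rpredM|exact: natr_int].
- rewrite addrAC mulrBl; apply: rpredB => //.
  by apply: step => //; exact: dvdn_mulr.
- move=> i; rewrite ltnS leq_eqVlt => /predU1P[->|lin] ip inp.
    have -> : (c - a * u * (p * n.-1`!)%:R - v n) / n%:R = (c - v n) * w.
      have -> : c - a * u * (p * n.-1`!)%:R - v n =
         (c - v n) * (1 - u * (p ^ k.+1 * n.-1`!)%:R).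
        by rewrite /a !natrM natrX exprS; ring.
      have -> : 1 - u * (p ^ k.+1 * n.-1`!)%:R = w * n%:R.
        by apply/eqP; rewrite subr_eq addrC uw.
      by rewrite mulrA mulfK.
    apply: pfracM; [exact: pfracB|exact: int_pfrac].
  rewrite addrAC mulrBl; apply: pfracB; first exact: cv.
  apply/int_pfrac/step => //; apply: dvdn_mull; apply: dvdn_fact.
  by rewrite prime_gt0 // -ltnS prednK // prime_gt0.
Qed.

End LocalFractions.

(** * Extending homomorphisms into Z[1/p]/Z *)

(** Adjoining [A0] to each set lets Zorn's lemma cope with the empty chain, whose union need not
    satisfy [P]. *)
Lemma Zorn_above (T : Type) (P : set (set T)) (A0 : set T) : P A0 ->
  (forall F : set (set T), F !=set0 -> F `<=` P -> total_on F subset ->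
    P (\bigcup_(X in F) X)) ->
  exists A, [/\ A0 `<=` A, P A & forall B, A `<=` B -> P B -> B `<=` A].
Proof.
move=> PA0 chainP; have [F FP Ftot|A [PA Amax]] := @Zorn_bigcup T [set X | P (A0 `|` X)].
  have [->|/set0P[Y FY]] := eqVneq F set0; first by rewrite /= bigcup_set0 setU0.
  rewrite /=; have -> : A0 `|` \bigcup_(X in F) X = \bigcup_(X in [set A0 `|` X | X in F]) X.
    apply/seteqP; split=> [t [A0t|[X FX Xt]]|t [_ [X FX <-]] [A0t|Xt]].
    - by exists (A0 `|` Y); [exists Y|left].
    - by exists (A0 `|` X); [exists X|right].
    - by left.
    - by right; exists X.
  apply: chainP; first by exists (A0 `|` Y), Y.
    by move=> _ [X FX <-]; exact: FP.
  move=> _ _ [X FX <-] [Z FZ <-].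
  by have [XZ|ZX] := Ftot _ _ FX FZ; [left|right]; exact: setUS.
exists (A0 `|` A); split=> // B AB PB; apply: contrapT => BA.
apply: (Amax B).
  split; first by move=> t At; apply: AB; right.
  by move=> BA'; apply: BA => t /BA'; right.
rewrite /= (_ : A0 `|` B = B) //; apply/setUidPr => t A0t; apply: AB; by left.
Qed.

Lemma pair_mulrz (U V : zmodType) (x : U) (y : V) k : (x, y) *~ k = (x *~ k, y *~ k).
Proof.
rewrite [LHS]surjective_pairing; congr pair.
  exact: (raddfMz (@fst U V) k (x, y)).
exact: (raddfMz (@snd U V) k (x, y)).
Qed.

Section Extension.
Variables (G : zmodType) (p : nat).
Hypothesis p_prime : prime p.

(** The graph of a homomorphism from a subgroup to Z[1/p]/Z, given by representatives; the condition
    over 0 is single-valuedness modulo integers. *)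
Definition partial_lift (C : set (G * rat)) :=
  [/\ subgroup C, forall r, C (0, r) -> r \is a Num.int & forall z, C z -> pfrac p z.2].

Lemma partial_lift_bigcup (F : set (set (G * rat))) : F !=set0 ->
  F `<=` partial_lift -> total_on F subset -> partial_lift (\bigcup_(X in F) X).
Proof.
move=> [Y FY] FP Ftot; split=> [|r [X /FP[_ X0 _] /X0//]|z [X /FP[_ _ XP] /XP//]].
apply/subgroupP; split; first by exists Y => //; have [sY _ _] := FP _ FY; exact: subgroup0.
move=> x y [X FX Xx] [Z FZ Zy]; have [XZ|ZX] := Ftot _ _ FX FZ.
  exists Z => //; have [sZ _ _] := FP _ FZ; apply: subgroupB => //; exact: XZ.
exists X => //; have [sX _ _] := FP _ FX; apply: subgroupB => //; exact: ZX.
Qed.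

(** The multipliers taking [x] into the domain form an ideal; divisibility of Z[1/p]/Z yields a
    [d]-th part of the value at its generator [d]. *)
Lemma partial_lift_value C x : partial_lift C ->
  exists2 r0, pfrac p r0 & forall k r, C (x *~ k, r) -> r0 *~ k - r \is a Num.int.
Proof.
move=> [sC C0 CP].
have [|d dP] := @int_subgroup_principal [set k | exists r, C (x *~ k, r)].
  apply/subgroupP; split; first by exists 0; rewrite mulr0z; exact: subgroup0 sC.
  move=> k l [r kr] [s ls]; exists (r - s); rewrite mulrzBr.
  exact: subgroupB sC kr ls.
have [d0|d0] := posnP d.
  exists 0; first exact/int_pfrac/int_num0.
  move=> k r Ckr; have /dP : exists r, C (x *~ k, r) by exists r.
  rewrite d0 dvd0z => /eqP k0; move: Ckr.
  by rewrite k0 !mulr0z sub0r rpredN => /C0.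
have [q Cq] : exists r, C (x *~ d, r) by apply/dP; exact: dvdzz.
have [r0 r0P r0q] := pfrac_div p_prime d0 (CP _ Cq).
exists r0 => // k r Ckr; have /dP/dvdzP[l kE] : exists r, C (x *~ k, r) by exists r.
have : q *~ l - r \is a Num.int.
  apply: C0; have := subgroupB sC (subgroupMz l sC Cq) Ckr.
  have -> // : (x *~ d, q) *~ l - (x *~ k, r) = (0, q *~ l - r).
  by rewrite pair_mulrz kE mulrC mulrzA; congr pair; rewrite /= subrr.
move=> qr; rewrite (_ : _ - _ = (r0 * d%:R - q) *~ l + (q *~ l - r)).
  by rewrite rpredD // rpredMz.
by rewrite kE mulrzBl addrA subrK mulrC mulrzA -pmulrn mulr_natr.
Qed.

Lemma partial_lift_step C x : partial_lift C ->
  (forall B, C `<=` B -> partial_lift B -> B `<=` C) -> exists r, C (x, r).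
Proof.
move=> PC Cmax; have [r0 r0P r0C] := partial_lift_value x PC.
have [sC C0 CP] := PC.
pose D := [set z | exists w k, C w /\ z = (w.1 + x *~ k, w.2 + r0 *~ k)].
exists r0; apply: (Cmax D).
- by move=> [g r] Cz; exists (g, r), 0; rewrite !mulr0z !addr0.
- split.
  + apply/subgroupP; split.
      by exists 0, 0; split; [exact: subgroup0|rewrite !mulr0z !addr0].
    move=> _ _ [w [k [Cw ->]]] [z [l [Cz ->]]]; exists (w - z), (k - l).
    split; first exact: subgroupB.
    by rewrite !mulrzBr /=; congr pair; rewrite /= opprD addrACA.
  + move=> r [w [k [Cw [wx ->]]]].
    have /r0C : C (x *~ (- k), w.2).
      have -> : x *~ (- k) = w.1.
        by apply/eqP; rewrite mulrNz eq_sym -addr_eq0 -wx.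
      by rewrite -surjective_pairing.
    by rewrite mulrNz -opprD rpredN addrC.
  + move=> _ [w [k [Cw ->]]] /=; apply: pfracD; first exact: CP.
    rewrite -mulrzr; apply: pfracM => //; exact/int_pfrac/intr_int.
- by exists 0, 1; split; [exact: subgroup0|rewrite !add0r !mulr1z].
Qed.

(** Sending [b *~ k + x *+ p] to k/p is single-valued modulo integers since [b] is not [p] times an
    element of [B]. Zorn's lemma extends this map; [psi] chooses representatives, hence is additive
    only modulo integers. *)
Lemma extend_mod_int (B : set G) b : subgroup B -> B b ->
  (forall x, B x -> b != x *+ p) ->
  exists psi : G -> rat,
    [/\ forall g, pfrac p (psi g),
        forall g h, psi (g - h) - (psi g - psi h) \is a Num.int,
        forall x, B x -> psi (x *+ p) \is a Num.int &
        psi b - p%:R^-1 \is a Num.int].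
Proof.
move=> sB Bb bp.
pose C0 := [set z : G * rat | exists (k : int) x (m : int), B x /\
  z = (b *~ k + x *+ p, k%:~R / p%:R + m%:~R)].
have p0 : p%:R != 0 :> rat by rewrite pnatr_eq0 -lt0n prime_gt0.
have PC0 : partial_lift C0.
  split.
  - apply/subgroupP; split.
      exists 0, 0, 0; split; first exact: subgroup0.
      by rewrite mulr0z mul0rn mul0r !addr0.
    move=> _ _ [k [x [m [Bx ->]]]] [l [y [n [By ->]]]].
    exists (k - l), (x - y), (m - n); split; first exact: subgroupB.
    rewrite !mulrzBr mulrnBl; congr pair; rewrite /=.
      by rewrite opprD addrACA.
    by ring.
  - move=> r [k [x [m [Bx [bk ->]]]]]; apply: rpredD; last exact: intr_int.
    have [/dvdzP[l ->]|] := boolP (p%:Z %| k)%Z.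
      by rewrite rmorphM /= mulfK // intr_int.
    (* If [p] does not divide [k], Bezout turns the relation into a [p]-th part of [b] in [B]. *)
    rewrite dvdzE -prime_coprime // => kp; have [u [v uv]] := Bezoutz k p.
    have bE : b = (b *~ v - x *~ u) *+ p.
      rewrite -[LHS]mulr1z -[X in b *~ X]/(1%N%:Z) -(eqP kp) gcdnC -[Posz _]/(gcdz k p) -uv.
      rewrite mulrzDr [u * _]mulrC !mulrzA (_ : b *~ k = - (x *+ p)); last first.
        by apply/eqP; rewrite -addr_eq0 -bk.
      by rewrite mulrnBl addrC mulNrz !pmulrn -!mulrzA [u * _]mulrC.
    have /bp/eqP[] // : B (b *~ v - x *~ u).
    by apply: subgroupB => //; exact: subgroupMz.
  - move=> _ [k [x [m [Bx ->]]]] /=; apply: pfracD; last exact/int_pfrac/intr_int.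
    by apply: pfracM; [exact/int_pfrac/intr_int|exact: pfracV].
have [C [C0C PC Cmax]] := Zorn_above PC0 partial_lift_bigcup.
have [sC Ck CP] := PC.
have tot x : exists r, C (x, r) by exact: partial_lift_step.
have [psi psiP] := choice tot; exists psi.
have diff g r : C (g, r) -> psi g - r \is a Num.int.
  move=> Cg; apply: Ck; have := subgroupB sC (psiP g) Cg.
  by congr C; congr pair; rewrite /= subrr.
split=> [g|g h|x Bx|].
- exact: CP (psiP g).
- exact/diff/(subgroupB sC (psiP g) (psiP h)).
- rewrite -[psi _]subr0; apply/diff/C0C; exists 0, x, 0.
  by rewrite mulr0z add0r mul0r addr0.
- apply/diff/C0C; exists 1, 0, 0; split; first exact: subgroup0.
  by rewrite mulr1z mul0rn !addr0 mul1r.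
Qed.

End Extension.

(** * The group of a ladder system *)

Section LadderGroup.
Variables (d : Order.disp_t) (W : orderType d) (S : set W) (eta : W -> nat -> W).

(** The latest entry comes first, so that passing to a longer initial segment is a cons. *)
Fixpoint node (delta : W) n : seq W :=
  if n is m.+1 then eta delta m :: node delta m else [::].

Lemma size_node delta n : size (node delta n) = n.
Proof. by elim: n => //= n ->. Qed.

(* A vector is encoded by its values under all linear functionals [phi], which are
   arbitrary functions on the basis. *)
Definition coordinates := (seq W + W)%type -> rat.

Inductive generator := GenX of seq W | GenY of W | GenZ of W & nat.

Definition admissible j := match j with
  | GenX _ => True | GenY delta => S delta | GenZ delta q => S delta /\ prime q end.

Definition gen_fun j : coordinates -> rat := fun phi => match j with
  | GenX s => phi (inl s)
  | GenY delta => phi (inr delta)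
  | GenZ delta q => (phi (inr delta) - phi (inl (node delta q))) / q%:R end.

Definition ladder_set : set (coordinates -> rat) :=
  Zspan [set gen_fun j | j in admissible].

Definition ladder_pred : {pred coordinates -> rat} := mem ladder_set.

Lemma ladder_closed : zmod_closed ladder_pred.
Proof. exact: subgroup_Zspan. Qed.

HB.instance Definition _ :=
  GRing.isZmodClosed.Build _ ladder_pred ladder_closed.

Record ladder_group := LadderGroup {
  ladder_val : coordinates -> rat; _ : ladder_val \in ladder_pred }.

HB.instance Definition _ := [isSub for ladder_val].
HB.instance Definition _ := [Choice of ladder_group by <:].
HB.instance Definition _ := [SubChoice_isSubZmodule of ladder_group by <:].

Implicit Types (phi : coordinates) (g : ladder_group).

Definition ev phi g := val g phi.

Lemma ev_is_additive phi : zmod_morphism (ev phi).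
Proof. by move=> g h; rewrite /ev raddfB. Qed.

HB.instance Definition _ phi :=
  GRing.isZmodMorphism.Build ladder_group rat (ev phi) (ev_is_additive phi).

Lemma ev_inj g h : (forall phi, ev phi g = ev phi h) -> g = h.
Proof. by move=> gh; apply/val_inj/funext. Qed.

Definition gen j : ladder_group := insubd 0 (gen_fun j).

Lemma ev_gen j phi : admissible j -> ev phi (gen j) = gen_fun j phi.
Proof.
by move=> aj; rewrite /ev insubdK //; apply/mem_set/sub_Zspan; exists j.
Qed.

Lemma ladder_span g : Zspan [set gen j | j in admissible] g.
Proof.
have [A sA genA] : exists2 A, subgroup A &
    A = [set val g | g in Zspan [set gen j | j in admissible]].
  eexists; last by [].
  apply/subgroupP; split; first by exists 0 => //; exact: (subgroup0 (subgroup_Zspan _)).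
  move=> _ _ [x Ax <-] [y Ay <-]; exists (x - y); last exact: raddfB.
  exact: subgroupB (subgroup_Zspan _) _ _.
have : A (val g).
  apply: (Zspan_min sA); last exact: set_mem (valP g).
  move=> _ [j aj <-]; rewrite genA; exists (gen j); first by apply: sub_Zspan; exists j.
  by apply/funext => phi; exact: ev_gen.
by rewrite genA => -[h Ah /val_inj <-].
Qed.

Lemma ladder_ind (P : set ladder_group) : subgroup P ->
  (forall j, admissible j -> P (gen j)) -> forall g, P g.
Proof.
by move=> sP Pgen g; apply: Zspan_min (ladder_span g) => // _ [j aj <-]; exact: Pgen.
Qed.

Lemma evB phi phi' g : ev (phi - phi') g = ev phi g - ev phi' g.
Proof.
apply: (@ladder_ind [set g | ev (phi - phi') g = ev phi g - ev phi' g]).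
  apply/subgroupP; split; first by rewrite /= !raddf0 subrr.
  by move=> x y Px Py; rewrite /= !ev_is_additive Px Py; ring.
by move=> [s|e|e q] aj; rewrite /= !ev_gen //=; rewrite -mulrBl opprD addrACA -opprD.
Qed.

Lemma evZ (c : rat) phi g : ev (fun i => c * phi i) g = c * ev phi g.
Proof.
apply: (@ladder_ind [set g | ev (fun i => c * phi i) g = c * ev phi g]).
  apply/subgroupP; split; first by rewrite /= !raddf0 mulr0.
  by move=> x y Px Py; rewrite /= !ev_is_additive Px Py mulrBr.
by move=> [s|e|e q] aj; rewrite /= !ev_gen //= -mulrBr mulrA.
Qed.

Lemma gen_relation delta q : S delta -> prime q ->
  gen (GenY delta) = gen (GenX (node delta q)) + gen (GenZ delta q) *+ q.
Proof.
move=> Sd pq; apply: ev_inj => phi; rewrite raddfD raddfMn /= !ev_gen //=.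
by rewrite -[X in _ = _ + X]mulr_natr mulfVK ?pnatr_eq0 -?lt0n ?prime_gt0 // addrC subrK.
Qed.

(** * Guessing the value at a limit along a branch *)

Section Lifting.
Variable p : nat.
(** [crt] stands for chosen solutions of the Chinese remainder problem, [base] for the prescribed
    values at the x_s, [col] for the decoded colours. *)
Variables (crt : rat -> (nat -> rat) -> nat -> rat) (base : seq W -> rat) (col : W -> rat).

Hypothesis crtP : forall r v n, pfrac p r -> (forall i, pfrac p (v i)) ->
  let c := crt r v n in [/\ pfrac p c, (c - r) / p%:R \is a Num.int &
    forall i, (i < n)%N -> prime i -> i != p -> pfrac p ((c - v i) / i%:R)].
Hypothesis base_pfrac : forall s, pfrac p (base s).
Hypothesis col_pfrac : forall a, pfrac p (col a).

(* The running guess for the value at the limit of a branch, together with the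
   values already assigned along the branch (indexed by length). The guess is
   only revised when it disagrees modulo p with the colour just read, and the
   revision stays congruent to the assigned value of length i modulo i. *)
Fixpoint guess (s : seq W) : rat * (nat -> rat) :=
  if s is a :: t then
    let: (c, v) := guess t in
    let c' := if (c - col a) / p%:R \is a Num.int then c
              else crt (col a) v (size s) in
    (c', fun i => if i == size s then crt (base s) (fun=> c') (size s).+1 else v i)
  else (0, fun=> base [::]).

Definition assigned s := (guess s).2 (size s).

Lemma guess_pfrac s : pfrac p (guess s).1 /\ forall i, pfrac p ((guess s).2 i).
Proof.
elim: s => [|a t [cP vP]] /=; first by split=> //; exact/int_pfrac/int_num0.
case: (guess t) cP vP => c v /= cP vP.
have c'P : pfrac p (if (c - col a) / p%:R \is a Num.int then c else crt (col a) v (size t).+1).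
  by case: ifP => // _; have [] := @crtP (col a) v (size t).+1.
split=> // i; case: ifP => // _.
by have [] := @crtP (base (a :: t)) (fun=> _) (size t).+2 (base_pfrac _) (fun=> c'P).
Qed.

(** At the newest length the assigned value was solved against the guess, for prime moduli up to and
    including [size s]; at earlier lengths the congruence is inherited or built into the
    revision. *)
Lemma guess_congr s i : (i <= size s)%N -> prime i -> i != p ->
  pfrac p (((guess s).1 - (guess s).2 i) / i%:R).
Proof.
elim: s i => [|a t IH] i /=; first by rewrite leqn0 => /eqP ->.
have [cP vP] := guess_pfrac t; have [] := guess_pfrac (a :: t) => /=.
case: (guess t) cP vP IH => c v /= cP vP IH c'P _.
rewrite leq_eqVlt => /predU1P[->|it] ip inp.
  rewrite eqxx; move: (if _ \is a _ then _ else _) c'P => c' c'P.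
  have [_ _ /(_ _ (ltnSn _) ip inp) h] :=
     @crtP (base (a :: t)) (fun=> c') (size t).+2 (base_pfrac _) (fun=> c'P).
  by have := pfracN h; rewrite -mulNr opprB.
rewrite ltn_eqF //; case: ifP => _; first exact: IH.
by have [_ _ /(_ i it ip inp)] := @crtP (col a) v (size t).+1 (col_pfrac _) vP.
Qed.

Lemma guess_color a t : ((guess (a :: t)).1 - col a) / p%:R \is a Num.int.
Proof.
have [cP vP] := guess_pfrac t; case E: (guess t) cP vP => [c v] /= cP vP.
rewrite /= E /=; case: ifP => // _.
by have [] := @crtP (col a) v (size t).+1 (col_pfrac _) vP.
Qed.

Lemma guess_keep a t : ((guess t).1 - col a) / p%:R \is a Num.int ->
  (guess (a :: t)).1 = (guess t).1.
Proof. by rewrite /=; case: (guess t) => c v /= ->. Qed.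

Lemma assigned_base s : (assigned s - base s) / p%:R \is a Num.int.
Proof.
rewrite /assigned; case: s => [|a t]; first by rewrite subrr mul0r int_num0.
have [c'P _] := guess_pfrac (a :: t); move: c'P => /=.
case: (guess t) => c v /= c'P; rewrite eqxx.
by have [] := @crtP (base (a :: t)) (fun=> _) (size t).+2 (base_pfrac _) (fun=> c'P).
Qed.

(** The update at each step touches only the newest length. *)
Lemma guess_node delta n i : (i <= n)%N ->
  (guess (node delta n)).2 i = assigned (node delta i).
Proof.
elim: n => [|n IH]; first by rewrite leqn0 => /eqP ->.
rewrite leq_eqVlt => /predU1P[->|in_]; first by rewrite /assigned size_node.
by rewrite -IH //=; case: (guess _) => c v /=; rewrite size_node ltn_eqF.
Qed.

(** Once the colours are constantly [r], the guess is congruent to [r] modulo [p], every further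
    test succeeds, and no revision occurs again. *)
Lemma guess_limit delta r N : (forall n, (N <= n)%N -> col (eta delta n) = r) ->
  exists c, [/\ pfrac p c, (c - r) / p%:R \is a Num.int &
    forall i, prime i -> i != p -> pfrac p ((c - assigned (node delta i)) / i%:R)].
Proof.
(* Length [N.+1] is the first at which the colour of index [N] has been read. *)
move=> colr; pose c n := (guess (node delta (N.+1 + n))).1.
have cr n : (c n - r) / p%:R \is a Num.int.
  rewrite -(colr (N + n)%N (leq_addr _ _)); exact: guess_color.
have cE n : c n = c 0%N.
  elim: n => // n <-; rewrite /c addnS; apply: guess_keep.
  by rewrite colr ?leqW ?leq_addr //; exact: cr.
exists (c 0%N); split; first by have [] := guess_pfrac (node delta (N.+1 + 0)).
  exact: cr.
move=> i ip inp; rewrite -(cE i) -(@guess_node delta (N.+1 + i)) ?leq_addl //.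
by apply: guess_congr => //; rewrite size_node leq_addl.
Qed.

End Lifting.

Lemma lift_mod_int p (psi : ladder_group -> rat) :
  monochromatic_uniformization S eta -> prime p ->
  (forall g, pfrac p (psi g)) ->
  (forall g h, psi (g - h) - (psi g - psi h) \is a Num.int) ->
  exists phi, forall g, ev phi g - psi g \is a Num.int.
Proof.
move=> unif p_prime psiP psiB.
have p0 : p%:R != 0 :> rat by rewrite pnatr_eq0 -lt0n prime_gt0.
have crt_ex (x : rat * (nat -> rat) * nat) : exists c,
    pfrac p x.1.1 -> (forall i, pfrac p (x.1.2 i)) ->
    [/\ pfrac p c, (c - x.1.1) / p%:R \is a Num.int &
    forall i, (i < x.2)%N -> prime i -> i != p -> pfrac p ((c - x.1.2 i) / i%:R)].
  case: x => [[r v] n]; have [[rP vP]|h] := pselect (pfrac p r /\ forall i, pfrac p (v i)).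
    by have [c cP] := chinese_pfrac p_prime n rP vP; exists c.
  by exists 0 => rP vP; case: h.
have [crt0 crt0P] := choice crt_ex.
pose crt r v n := crt0 (r, v, n).
(* The value at y_delta prescribed by the relation for [p]; it matters modulo [p], not just modulo
   1, because that relation divides by [p]. *)
pose r delta := psi (gen (GenX (node delta p))) + p%:R * psi (gen (GenZ delta p)).
have rP delta : pfrac p (r delta).
  by apply: pfracD => //; apply: pfracM => //; exact/int_pfrac/natr_int.
have [f [fstar fP]] := unif (fun delta => pickle (r delta)).
(* Invalid codes and codes of rationals outside Z[1/p] are read as 0, so that [colP] holds
   everywhere. *)
pose col a := let x := odflt 0 (unpickle (f a)) in if `[< pfrac p x >] then x else 0.
have colP a : pfrac p (col a).
  by rewrite /col; case: asboolP => // _; exact/int_pfrac/int_num0.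
pose base s := psi (gen (GenX s)).
have baseP s : pfrac p (base s) by exact: psiP.
have crtP r0 v n := crt0P (r0, v, n).
have colE delta n : S delta -> (fstar delta <= n)%N -> col (eta delta n) = r delta.
  by move=> Sd dn; rewrite /col fP // pickleK /= asboolT.
pose X := assigned p crt base col.
have Y_ex delta : exists c, S delta ->
    [/\ pfrac p c, (c - r delta) / p%:R \is a Num.int &
    forall i, prime i -> i != p -> pfrac p ((c - X (node delta i)) / i%:R)].
  have [Sd|nS] := pselect (S delta); last by exists 0.
  have [c cP] := guess_limit crtP baseP colP (fun n => colE delta n Sd).
  by exists c.
have [Y YP] := choice Y_ex.
pose phi : coordinates := fun i => match i with inl s => X s | inr e => Y e end.
have psi0 : psi 0 \is a Num.int.
  by have := psiB 0 0; rewrite !subrr subr0.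
have psiN g : psi (- g) + psi g \is a Num.int.
  have := rpredD (psiB 0 g) psi0.
  by rewrite sub0r; congr (_ \is a Num.int); ring.
have psiD g h : psi (g + h) - (psi g + psi h) \is a Num.int.
  have := rpredB (psiB g (- h)) (psiN h); rewrite opprK.
  by congr (_ \is a Num.int); ring.
have psiMn g n : psi (g *+ n) - psi g * n%:R \is a Num.int.
  elim: n => [|n IH]; first by rewrite mulr0n mulr0 subr0.
  have := rpredD (psiD g (g *+ n)) IH; rewrite -mulrS.
  by congr (_ \is a Num.int); rewrite -natr1; ring.
have pZ (x : rat) : x / p%:R \is a Num.int -> x \is a Num.int.
  by move=> xp; rewrite -(mulfVK p0 x) rpredM ?natr_int.
have Xpsi s : X s - psi (gen (GenX s)) \is a Num.int.
  by apply/pZ/(assigned_base crtP baseP colP).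
have Ypsi delta q : S delta -> prime q ->
  psi (gen (GenY delta)) -
    (psi (gen (GenX (node delta q))) + psi (gen (GenZ delta q)) * q%:R) \is a Num.int.
  move=> Sd pq; rewrite (gen_relation Sd pq).
  have := rpredD (psiD (gen (GenX (node delta q))) (gen (GenZ delta q) *+ q))
    (psiMn (gen (GenZ delta q)) q).
  by congr (_ \is a Num.int); ring.
have YY delta : S delta -> Y delta - psi (gen (GenY delta)) \is a Num.int.
  move=> Sd; have [_ /pZ Yr _] := YP _ Sd.
  have := rpredB Yr (Ypsi _ p Sd p_prime).
  by congr (_ \is a Num.int); rewrite /r; ring.
exists phi; apply: ladder_ind.
  apply/subgroupP; split; first by rewrite /= raddf0 sub0r rpredN.
  move=> g h /= gZ hZ; have := rpredB (rpredB gZ hZ) (psiB g h).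
  by congr (_ \is a Num.int); rewrite raddfB /=; ring.
move=> [s|e|e q] aj; rewrite /= ev_gen //=; first exact: YY.
have [Se q_prime] := aj; have [YeP Yr Yq] := YP _ Se.
have q0 : q%:R != 0 :> rat by rewrite pnatr_eq0 -lt0n prime_gt0.
(* For [q = p] the congruences modulo [p] at y and x are subtracted; otherwise the error lies in
   Z[1/p] and [q] times it is an integer. *)
have [qp|qp] := eqVneq q p.
  have := rpredB Yr (assigned_base crtP baseP colP (node e p)).
  by congr (_ \is a Num.int); rewrite qp /r /base -/X; field.
apply: (@pfrac_coprime_int p q).
- by rewrite prime_coprime // dvdn_prime2.
- apply: pfracB => //; exact: Yq.
- have := rpredD (rpredB (YY _ Se) (Xpsi (node e q))) (Ypsi _ _ Se q_prime).
  by congr (_ \is a Num.int); field.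
Qed.

End LadderGroup.

(** * Integral functionals *)

Section Functionals.
Variables (d : Order.disp_t) (W : orderType d) (S : set W) (eta : W -> nat -> W).
Local Notation G := (ladder_group S eta).
Implicit Types (phi : coordinates W) (g : G).

(** The values at [b] of functionals integral on [B] form an ideal of the integers. A prime [p]
    dividing its generator is excluded by [p] times a lift of a homomorphism sending [b] to 1/p. *)
Lemma ladder_unit_functional (B : set G) b :
  monochromatic_uniformization S eta -> subgroup B -> B b ->
  (forall p x, prime p -> B x -> b != x *+ p) ->
  exists2 u : {additive G -> rat}, (forall x, B x -> u x \is a Num.int) & u b = 1.
Proof.
move=> unif sB Bb bp.
pose I := [set k : int | exists phi,
  (forall x, B x -> ev phi x \is a Num.int) /\ ev phi b = k%:~R].
have [|e eP] := @int_subgroup_principal I.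
  apply/subgroupP; split.
    exists 0; split=> [x Bx|].
      by rewrite -[0](subrr 0) evB subrr int_num0.
    by rewrite -[0](subrr 0) evB subrr.
  move=> k l [phi [phiZ phib]] [phi' [phi'Z phi'b]]; exists (phi - phi').
  split=> [x Bx|]; first by rewrite evB rpredB ?phiZ ?phi'Z.
  by rewrite evB phib phi'b rmorphB.
have [e1|e1] := eqVneq e 1%N.
  have [phi [phiZ phib]] : I 1 by apply/eP; rewrite e1.
  by exists (ev phi).
have [p p_prime pe] : exists2 p, prime p & (p %| e)%N.
  case: (ltngtP e 1%N) e1 => // [|e1 _].
    by rewrite ltnS leqn0 => /eqP -> _; exists 2%N.
  by exists (pdiv e); rewrite ?pdiv_prime ?pdiv_dvd.
have p0 : p%:R != 0 :> rat by rewrite pnatr_eq0 -lt0n prime_gt0.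
have [psi [psiP psiB psiBp psib]] := extend_mod_int p_prime sB Bb (fun x => bp p x p_prime).
have [phi phiE] := lift_mod_int unif p_prime psiP psiB.
have phiB x : B x -> p%:R * ev phi x \is a Num.int.
  move=> Bx; have := rpredD (phiE (x *+ p)) (psiBp x Bx).
  by rewrite subrK raddfMn /= mulr_natl.
have /intrP[k kE] := phiB b Bb.
have /eP ek : I k.
  by exists (fun i => p%:R * phi i); split=> [x Bx|]; rewrite evZ ?kE ?phiB.
have /dvdzP[l kl] : (p%:Z %| k)%Z by apply: dvdz_trans ek; rewrite dvdzE.
have phib : ev phi b \is a Num.int.
  by rewrite -(mulKf p0 (ev phi b)) kE kl rmorphM /= mulrC mulfK // intr_int.
(* Integrality at [b] contradicts the value of the lift being 1/p modulo integers. *)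
have : p%:R^-1 \is a @Num.int rat.
  have := rpredB phib (rpredD (phiE b) psib).
  by congr (_ \is a Num.int); ring.
move=> /intrP[m mE]; have /eqP : (p%:Z * m)%:~R = 1%:~R :> rat.
  by rewrite rmorphM /= -mE mulfV.
rewrite eqr_int => /eqP pm.
have : (p %| 1)%N by have := dvdz_mulr m (dvdzz p); rewrite pm dvdzE.
by rewrite dvdn1 => /eqP p1; rewrite p1 in p_prime.
Qed.

Lemma node_eqP delta e n k : node eta delta n = node eta e n -> (k < n)%N ->
  eta delta k = eta e k.
Proof.
elim: n => // n IH /= [en nn]; rewrite ltnS leq_eqVlt => /predU1P[->//|].
exact: IH.
Qed.

Lemma drop_node delta m n : drop m (node eta delta (m + n)) = node eta delta n.
Proof. by elim: m => [|m IH]; rewrite ?drop0. Qed.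

(** For [delta < e] the ladder on [e] eventually reaches or passes [delta], while that on [delta]
    stays below it. *)
Lemma node_separates delta e : ladder_system S eta -> S delta -> S e ->
  delta != e -> exists n, forall N, (n <= N)%N -> node eta delta N != node eta e N.
Proof.
move=> [_ lad]; wlog : delta e / (delta < e)%O => [wl Sd Se de|de Sd Se _].
  case: (ltgtP delta e) de => // lt_de _; first by apply: wl => //; rewrite lt_eqF.
  have [|n nP] := wl e delta lt_de Se Sd; first by rewrite lt_eqF.
  by exists n => N nN; rewrite eq_sym nP.
have [_ _ /(_ _ de)[k dk]] := lad _ Se; have [dlt _ _] := lad _ Sd.
exists k.+1 => N kN; apply/eqP => /node_eqP /(_ kN) E.
by have := lt_le_trans (dlt k) dk; rewrite E ltxx.
Qed.

Lemma node_separates_seq (D : seq W) : ladder_system S eta ->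
  (forall delta, delta \in D -> S delta) ->
  exists n, forall N, (n <= N)%N -> {in D &, injective (fun delta => node eta delta N)}.
Proof.
move=> lad DS.
have sep (z : W * W) : exists n, S z.1 -> S z.2 -> z.1 != z.2 ->
    forall N, (n <= N)%N -> node eta z.1 N != node eta z.2 N.
  have [[S1 S2 z12]|h] := pselect [/\ S z.1, S z.2 & z.1 != z.2].
    by have [n nP] := node_separates lad S1 S2 z12; exists n.
  by exists 0%N => S1 S2 z12; case: h.
have [f fP] := choice sep.
exists (\max_(z <- [seq (x, y) | x <- D, y <- D]) f z)%N => N maxN x y xD yD /eqP xy.
apply: contraTeq xy => xy; apply: (fP (x, y)) => //; [exact: DS|exact: DS|].
by apply: leq_trans maxN; apply: leq_bigmax_seq => //; exact: allpairs_f.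
Qed.

Lemma ev_finite_support g : exists L : seq (seq W + W),
  (forall delta, inr delta \in L -> S delta) /\
  forall phi phi', {in L, phi =1 phi'} -> ev phi g = ev phi' g.
Proof.
apply: (@ladder_ind _ _ _ _ [set g | exists L : seq (seq W + W),
  (forall delta, inr delta \in L -> S delta) /\
  forall phi phi', {in L, phi =1 phi'} -> ev phi g = ev phi' g]).
  apply/subgroupP; split.
    by exists [::]; split=> // phi phi' _; rewrite !raddf0.
  move=> x y [L [LS Lx]] [M [MS My]]; exists (L ++ M); split.
    by move=> delta; rewrite mem_cat => /orP[/LS|/MS].
  move=> phi phi' LM; rewrite !ev_is_additive; congr (_ - _); [apply: Lx|apply: My];
    by move=> i iL; apply: LM; rewrite mem_cat iL ?orbT.
move=> [s|e|e q] aj.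
- exists [:: inl s]; split=> [delta|phi phi' E]; first by rewrite inE.
  by rewrite !ev_gen //= E ?inE.
- exists [:: inr e]; split=> [delta|phi phi' E]; first by rewrite inE => /eqP[->].
  by rewrite !ev_gen //= E ?inE.
- exists [:: inr e; inl (node eta e q)]; split=> [delta|phi phi' E].
    by rewrite !inE orbF => /eqP[->]; case: aj.
  by rewrite !ev_gen //= !E ?inE ?eqxx ?orbT.
Qed.

Lemma common_denominator (T : eqType) (L : seq T) (phi : T -> rat) :
  exists K : rat, [/\ K \is a Num.int, K != 0 & {in L, forall i, K * phi i \is a Num.int}].
Proof.
elim: L => [|i L [K [KZ K0 KL]]]; first by exists 1; split=> //; exact: int_num1.
exists (K * (denq (phi i))%:~R); split; first by rewrite rpredM ?intr_int.
  by rewrite mulf_neq0 // intr_eq0 denq_neq0.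
move=> j; rewrite inE => /predU1P[->|jL].
  by rewrite -mulrA [_ * phi i]mulrC -numqE rpredM ?intr_int.
by rewrite mulrAC; apply: rpredM; [exact: KL|exact: intr_int].
Qed.

(** A functional is scaled to be integral on the support of [g] and spread along the tree: from
    length [N] on, x_s takes the value of its initial segment of length [N], matching y_delta. Only
    primes below [N] then need the factorial factor. *)
Lemma ladder_enough_functionals g : ladder_system S eta -> g != 0 ->
  exists2 u : {additive G -> rat}, (forall x, u x \is a Num.int) & u g != 0.
Proof.
move=> lad g0.
have [phi0 phi0g] : exists phi, ev phi g != 0.
  apply: contrapT => h; move/eqP: g0; apply; apply: ev_inj => phi; rewrite raddf0.
  by apply: contrapT => /eqP e0; apply: h; exists phi.
have [L [LS Lg]] := ev_finite_support g.
have [K [_ K0 KL]] := common_denominator L phi0.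
pose D := pmap (fun i : seq W + W => if i is inr e then Some e else None) L.
have memD e : (e \in D) = (inr e \in L).
  rewrite mem_pmap; apply/mapP/idP => [[[s|e'] //= iL [->]]//|eL]; by exists (inr e).
have [|n0 n0P] := @node_separates_seq D lad; first by move=> e; rewrite memD; exact: LS.
(* The successor makes every x_s in the support strictly shorter than [N]. *)
pose len (i : seq W + W) := if i is inl s then (size s).+1 else 0%N.
pose N := maxn n0 (\max_(i <- L) len i)%N.
have Dinj := n0P N (leq_maxl _ _).
have sizeN s : inl s \in L -> (size s < N)%N.
  move=> sL; rewrite -[X in (X <= _)%N]/(len (inl s)).
  by apply: leq_trans (leq_maxr _ _); exact: leq_bigmax_seq.
pose c i := if i \in L then K * phi0 i else 0.
have cZ i : c i \is a Num.int by rewrite /c; case: ifP => [/KL|_] //; exact: int_num0.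
(* Nodes of length [N] separate the points of [D], so the value wanted at y_e can be attached to the
   node of [e]; other nodes get 0. *)
pose E t := if pselect (exists2 e, e \in D & node eta e N = t) is left h
  then c (inr (sval (cid2 h))) else 0.
have EZ t : E t \is a Num.int by rewrite /E; case: pselect => // _; exact: int_num0.
have EN e : e \in D -> E (node eta e N) = c (inr e).
  move=> eD; rewrite /E; case: pselect => [h|[]]; last by exists e.
  by case: (cid2 h) => e' /= e'D /Dinj ->.
pose x s := if (size s < N)%N then c (inl s) else E (drop (size s - N) s).
have xZ s : x s \is a Num.int by rewrite /x; case: ifP.
pose phi : coordinates W := fun i => N`!%:R * match i with
  inl s => x s | inr e => E (node eta e N) end.
exists (ev phi).
  apply: ladder_ind.
    apply/subgroupP; split; first by rewrite /= raddf0 int_num0.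
    by move=> y z /= yZ zZ; rewrite raddfB rpredB.
  move=> [s|e|e q] aj; rewrite /= ev_gen //=; try by rewrite rpredM ?natr_int.
  have [_ q_prime] := aj; rewrite -mulrBr /x size_node.
  case: ltnP => qN; last first.
    by rewrite -{2}(subnK qN) drop_node subrr mulr0 mul0r int_num0.
  have /dvdnP[m ->] : (q %| N`!)%N by rewrite dvdn_fact // prime_gt0 //= ltnW.
  rewrite natrM mulrAC mulfK ?pnatr_eq0 -?lt0n ?prime_gt0 //.
  by rewrite rpredM ?natr_int ?rpredB.
rewrite /=; have -> : ev phi g = ev (fun i => (N`!%:R * K) * phi0 i) g.
  apply: Lg => -[s|e] iL; rewrite /phi -mulrA; congr (_ * _).
    by rewrite /x sizeN // /c iL.
  by rewrite EN ?memD // /c iL.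
by rewrite evZ !mulf_neq0 // pnatr_eq0 -lt0n fact_gt0.
Qed.

End Functionals.

(** * Cardinality and non-freeness *)

Lemma card_le_inj (T U : Type) (f : T -> U) : injective f -> [set: T] #<= [set: U].
Proof.
move=> finj; rewrite -(card_le_eql (inj_card_eq (f := f) _)); first exact: subset_card_le.
by move=> x y _ _; exact: finj.
Qed.

(** * Bounds and cardinal arithmetic in omega_1 *)

Section Omega1.
Variables (d : Order.disp_t) (W : orderType d).
Hypothesis hW : is_omega1 W.

Lemma omega1_min (A : set W) : A !=set0 ->
  exists2 z, A z & forall x, A x -> (z <= x)%O.
Proof.
move=> [x Ax]; have [wo _ _] := hW.
have [|z [[Az lbz] _]] := wo [in A]; first by exists x; rewrite !inE.
exists z; first by move: Az; rewrite inE.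
by move=> y Ay; apply: lbz; rewrite inE.
Qed.

Lemma omega1_wf : well_founded (fun a b : W => (a < b)%O).
Proof.
move=> a; apply: contrapT => na.
have [|z nz zmin] := @omega1_min [set a | ~ Acc (fun a b : W => (a < b)%O) a].
  by exists a.
apply: nz; constructor=> b bz; apply: contrapT => /zmin.
by rewrite leNgt bz.
Qed.

(** Otherwise [W] would be a countable union of countable closed initial segments. *)
Lemma omega1_bounded (A : set W) : countable A ->
  exists a, forall b, A b -> (b < a)%O.
Proof.
move=> cA; have [_ unc cW] := hW; apply: contrapT => nb; apply: unc.
have -> : [set: W] = \bigcup_(b in A) \bigcup_(i in [set: bool])
    (if i then [set a | (a < b)%O] else [set b]).
  apply/seteqP; split=> // a _; apply: contrapT => na; apply: nb; exists a => b Ab.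
  by case: ltgtP => // [ab|ba]; case: na; exists b => //; [exists true|exists false; rewrite //= ba].
apply: bigcup_countable => // b _; apply: bigcup_countable; first exact: countableP.
by move=> [] _; [exact: cW|exact: countable1].
Qed.

(* The values [iter n succ (b a)] below play the part of the ordinals omega * a + n. *)
Lemma omega1_mul_omega : exists2 f : W -> nat -> W,
  forall a, injective (f a) & forall a b m n, f a m = f b n -> a = b.
Proof.
have ub_ex (A : set W) : exists a, countable A -> forall b, A b -> (b < a)%O.
  have [cA|nA] := pselect (countable A).
    by have [a aP] := omega1_bounded cA; exists a.
  have [_ unc _] := hW; have [a _] : [set: W] !=set0.
    by apply/set0P; apply: contra_notN unc => /eqP ->.
  by exists a => /nA.
have [ub ubP] := choice ub_ex.
pose succ a := ub [set a].
have succP a : (a < succ a)%O by apply: ubP => //; exact: countable1.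
pose F (a : W) (rec : forall b : W, (b < a)%O -> W) :=
  ub [set x | exists (b : W) (ba : (b < a)%O) m, x = iter m succ (rec b ba)].
pose b := Fix omega1_wf (fun=> W) F.
have bE a : b a = ub [set x | exists c (ca : (c < a)%O) m, x = iter m succ (b c)].
  rewrite /b Fix_eq // => x f g fg; rewrite /F; congr ub.
  by apply/seteqP; split=> [y [c [ca [m ->]]]|y [c [ca [m ->]]]]; exists c, ca, m; rewrite fg.
have b_lt a c m : (c < a)%O -> (iter m succ (b c) < b a)%O.
  move=> ca; rewrite [b a]bE; apply: ubP; last by exists c, ca, m.
  have [_ _ cW] := hW.
  apply: (@sub_countable _ _ _ ([set c | (c < a)%O] `*` [set: nat])).
    rewrite (_ : [set _ | _] =
      [set iter z.2 succ (b z.1) | z in [set c | (c < a)%O] `*` [set: nat]]).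
      exact: card_image_le.
    apply/seteqP; split=> [x [e [ea [n ->]]]|x [[e n] [/= ea _] <-]].
      by exists (e, n).
    by exists e, ea, n.
  exact: countableX.
have it_lt x m n : (m < n)%N -> (iter m succ x < iter n succ x)%O.
  elim: n => // n IH; rewrite ltnS leq_eqVlt => /predU1P[->|/IH] /=; first exact: succP.
  by move=> h; apply: lt_trans h (succP _).
have it_ge x m : (x <= iter m succ x)%O.
  by case: m => // m; apply/ltW; exact: (it_lt x 0%N).
exists (fun a m => iter m succ (b a)).
  move=> a m n E; case: (ltngtP m n) => // /(it_lt (b a)); by rewrite E ltxx.
move=> a c m n E; case: (ltgtP a c) => // [ac|ca].
  by have := lt_le_trans (b_lt _ _ m ac) (it_ge (b c) n); rewrite E ltxx.
by have := lt_le_trans (b_lt _ _ n ca) (it_ge (b a) m); rewrite E ltxx.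
Qed.

(** An element [t] goes to place [e (rho t) t] in the omega-block of an index [rho t] whose set
    contains it. *)
Lemma card_le_omega1 (T : Type) (A : W -> set T) :
  (forall a, countable (A a)) -> (forall t, exists a, A a t) -> [set: T] #<= [set: W].
Proof.
move=> cA covA; have [rho rhoP] := choice covA.
have /choice[e eP] : forall a, exists f : T -> nat, {in A a &, injective f}.
  by move=> a; exact/countable_injP.
have [f finj fa] := omega1_mul_omega.
apply: (@card_le_inj _ _ (fun t => f (rho t) (e (rho t) t))) => t t' E.
have rE := fa _ _ _ _ E; move: E; rewrite rE => /finj.
by apply: eP; rewrite inE //; rewrite -rE.
Qed.

End Omega1.

(** * Filtration by countable layers and failure of freeness *)

Section Layers.
Variables (d : Order.disp_t) (W : orderType d) (S : set W) (eta : W -> nat -> W).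
Hypothesis hW : is_omega1 W.
Local Notation G := (ladder_group S eta).
Local Notation gen := (@gen d W S eta).
Implicit Types (a : W) (g : G).

Definition below a (j : generator W) := match j with
  | GenX s => all (fun b => b < a)%O s
  | GenY e => (e < a)%O
  | GenZ e _ => (e < a)%O end.

(** The strict bounds keep y_delta out of [layer delta], although x_s lies in it for every initial
    segment s of a ladder on [delta]. *)
Definition layer a : set G :=
  Zspan [set gen j | j in [set j | admissible S j /\ below a j]].

Lemma subgroup_layer a : subgroup (layer a).
Proof. exact: subgroup_Zspan. Qed.

Lemma gen_layer a j : admissible S j -> below a j -> layer a (gen j).
Proof. by move=> aj bj; apply: sub_Zspan; exists j. Qed.

Lemma below_mono a b j : (a <= b)%O -> below a j -> below b j.
Proof.
case: j => [s|e|e q] ab /=; try by move=> ea; exact: lt_le_trans ab.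
by apply: sub_all => c ca; exact: lt_le_trans ab.
Qed.

Lemma layer_mono a b : (a <= b)%O -> layer a `<=` layer b.
Proof.
move=> ab; apply: Zspan_mono => _ [j [aj bj] <-]; exists j => //; split=> //.
exact: below_mono bj.
Qed.

Lemma countable_layer a : countable (layer a).
Proof.
apply: countable_Zspan; apply: sub_countable (card_image_le _ _) _.
have [_ _ /(_ a)/countable_injP[f f_inj]] := hW.
apply/countable_injP; exists (fun j : generator W => pickle (match j with
  | GenX s => inl (inl (map f s)) | GenY e => inl (inr (f e))
  | GenZ e q => inr (f e, q) end : seq nat + nat + nat * nat)).
have finj b c : (b < a)%O -> (c < a)%O -> f b = f c -> b = c.
  by move=> ba ca; apply: f_inj; rewrite inE.
move=> j k; rewrite !inE => -[_ bj] [_ bk] /(pcan_inj pickleK).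
case: j k bj bk => [s|e|e q] [s'|e'|e' q'] //= bj bk [].
- elim: s s' bj bk => [|b s IH] [|c s'] //= /andP[ba sa] /andP[ca s'a] [/finj bc ss'].
  rewrite (bc ba ca); congr GenX; congr cons.
  by have [] := IH _ sa s'a ss'.
- by move=> /finj ->.
- by move=> /finj -> // ->.
Qed.

(** Each element involves finitely many points below [al], and [D] is directed since the order is
    linear; a member of [D] is needed even for the empty sequence. *)
Lemma layer_limit (al : W) (D : set W) g : D !=set0 ->
  (forall e, (e < al)%O -> exists2 c, D c & (e < c)%O) ->
  layer al g -> exists2 c, D c & layer c g.
Proof.
move=> [c0 Dc0] Dal.
have dir b c : D b -> D c -> exists2 e, D e & (b <= e)%O /\ (c <= e)%O.
  by move=> Db Dc; case: (leP b c) => bc; [exists c|exists b => //; split=> //; exact: ltW].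
apply: (@Zspan_min _ _ [set g | exists2 c, D c & layer c g]).
  apply/subgroupP; split; first by exists c0 => //; exact: (subgroup0 (subgroup_layer _)).
  move=> x y [b Db bx] [c Dc cy]; have [e De [be ce]] := dir _ _ Db Dc; exists e => //.
  by apply: (subgroupB (subgroup_layer e)); [exact: layer_mono bx|exact: layer_mono cy].
move=> _ [j [aj bj] <-].
suff [c Dc bc] : exists2 c, D c & below c j by exists c => //; exact: gen_layer.
case: j bj {aj} => [s|e|e q] /=; [|exact: Dal|exact: Dal].
elim: s => [|b s IH] /=; first by exists c0.
move=> /andP[/Dal[c Dc bc] /IH[e De se]]; have [h Dh [ch eh]] := dir _ _ Dc De.
exists h => //; apply/andP; split; first exact: lt_le_trans ch.
exact: (@below_mono e h (GenX s)) se.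
Qed.

Lemma layer_cover g : exists a, layer a g.
Proof.
apply: (@ladder_ind _ _ _ _ [set g | exists a, layer a g]).
  have [_ unc _] := hW; have [a0 _] : [set: W] !=set0.
    by apply/set0P; apply: contra_notN unc => /eqP ->.
  apply/subgroupP; split; first by exists a0; exact: (subgroup0 (subgroup_layer _)).
  move=> x y [a ax] [b bx]; exists (Order.max a b).
  apply: (subgroupB (subgroup_layer _)); [apply: layer_mono ax|apply: layer_mono bx];
    by rewrite le_max lexx ?orbT.
move=> j aj; suff [a ba] : exists a, below a j by exists a; exact: gen_layer.
case: j {aj} => [s|e|e q] /=.
- have [|a aP] := @omega1_bounded _ _ hW [set` s].
    by apply: finite_set_countable; apply/finite_seqP; exists s.
  by exists a; apply/allP => b /aP.
- by have [a aP] := omega1_bounded hW (countable1 e); exists a; exact: aP.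
- by have [a aP] := omega1_bounded hW (countable1 e); exists a; exact: aP.
Qed.

Lemma ladder_group_card : [set: G] #= [set: W].
Proof.
rewrite card_eq_le; apply/andP; split.
  exact: (card_le_omega1 hW countable_layer layer_cover).
apply: (@card_le_inj _ _ (fun a => gen (GenX [:: a]))) => a b E.
apply: contrapT => /eqP ab.
have := congr1 (ev (fun i => if i == inl [:: a] then 1 else 0)) E.
rewrite !ev_gen //= eqxx; case: eqP => [[ba]|_ /eqP]; first by rewrite ba eqxx in ab.
by rewrite oner_eq0.
Qed.

Lemma gen_notin_layer delta : S delta -> ~ layer delta (gen (GenY delta)).
Proof.
move=> Sd ld; pose phi : coordinates W := fun i => if i == inr delta then 1 else 0.
suff : ev phi (gen (GenY delta)) = 0.
  by rewrite ev_gen //= /phi eqxx => /eqP; rewrite oner_eq0.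
apply: (@Zspan_min _ _ [set g | ev phi g = 0]) ld.
  apply/subgroupP; split; first by rewrite /= raddf0.
  by move=> x y /= x0 y0; rewrite raddfB /= x0 y0 subrr.
have ne e : (e < delta)%O -> (@inr (seq W) W e == inr delta) = false.
  by move=> ed; apply/eqP => -[E]; rewrite E ltxx in ed.
by move=> _ [[s|e|e q] [aj bj] <-]; rewrite /= ev_gen //= /phi ?ne // subr0 mul0r.
Qed.

Section Basis.
Variable B : set G.
Hypothesis basisB : Zbasis [set: G] B.

Definition closed_layers : set W := [set a | layer a `<=` Zspan (B `&` layer a)].

(** Closure at limits is continuity of the layers. Unboundedness takes omega steps, each absorbing
    the basis supports of the countably many elements of a layer. *)
Lemma club_closed_layers : club closed_layers.
Proof.
have mono b c : (b <= c)%O -> Zspan (B `&` layer b) `<=` Zspan (B `&` layer c).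
  by move=> bc; apply: Zspan_mono => x [Bx lx]; split=> //; exact: layer_mono lx.
split.
  move=> delta [[a0 a0d] _] cof g gd.
  have [||c [Cc cd] cg] := @layer_limit delta (closed_layers `&` [set b | (b < delta)%O]) g _ _ gd.
  - by have [b Cb /andP[_ bd]] := cof _ a0d; exists b.
  - by move=> e /cof[b Cb /andP[eb bd]]; exists b.
  - exact: mono (ltW cd) _ (Cc _ cg).
have sup_ex g : exists c, Zspan (B `&` layer c) g.
  have [_ _ /(_ g I)] := basisB.
  apply: (@Zspan_min _ _ [set g | exists c, Zspan (B `&` layer c) g]).
    apply/subgroupP; split.
      have [a _] := layer_cover 0; exists a; exact: (subgroup0 (subgroup_Zspan _)).
    move=> x y [b bx] [c cy]; exists (Order.max b c).
    apply: (subgroupB (subgroup_Zspan _)); [apply: mono bx|apply: mono cy];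
      by rewrite le_max lexx ?orbT.
  move=> b Bb; have [c cb] := layer_cover b; exists c; exact: sub_Zspan.
have [rho rhoP] := choice sup_ex.
have next_ex a : exists b, (a < b)%O /\ layer a `<=` Zspan (B `&` layer b).
  have [b bP] := omega1_bounded hW (sub_countable (card_image_le rho _) (countable_layer a)).
  have [c cP] := omega1_bounded hW (countable1 a).
  exists (Order.max b c); split; first by rewrite lt_max cP ?orbT.
  move=> g ga; apply: mono (rhoP g); rewrite le_max ltW ?bP //; by exists g.
have [next nextP] := choice next_ex.
move=> a; pose s n := iter n next a.
have [b bP] : exists b, forall c, range s c -> (c < b)%O.
  by apply: omega1_bounded => //; apply: sub_countable (card_image_le _ _) _; exact: countableP.
(* The least strict upper bound of the iterates is their limit, so its layer is the union of
   theirs. *)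
have [|al alP almin] := @omega1_min _ _ hW [set b | forall c, range s c -> (c < b)%O].
  by exists b.
exists al; last by apply: alP; exists 0%N.
move=> g ga; have [||_ [n _ <-] ng] := @layer_limit al (range s) g _ _ ga.
- by exists (s 0%N), 0%N.
- move=> e eal; apply: contrapT => h; have /almin : forall c, range s c -> (c < e)%O.
    move=> _ [n _ <-]; rewrite ltNge; apply/negP => en; apply: h.
    exists (s n.+1); first by exists n.+1.
    by apply: le_lt_trans en _; have [] := nextP (s n).
  by rewrite leNgt eal.
- have [_ /(_ g ng)] := nextP (s n); apply: mono.
  by apply/ltW/alP; exists n.+1.
Qed.

(** The coefficient of y_delta at a basis element outside [layer delta] is divisible by every prime,
    hence zero; this would put y_delta into [layer delta]. *)
Lemma closed_layer_notin delta : ladder_system S eta -> S delta ->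
  ~ closed_layers delta.
Proof.
move=> lad Sd Cd; have [_ iB spB] := basisB.
have [s [a [us sB a0 yE]]] := (ZspanP _ _).1 (spB (gen (GenY delta)) I).
have a_dvd b q : b \in s -> ~ layer delta b -> prime q -> (q%:Z %| a b)%Z.
  move=> bs nb q_prime.
  have [t [c [ut tB c0 zE]]] := (ZspanP _ _).1 (spB (gen (GenZ delta q)) I).
  have lx : layer delta (gen (GenX (node eta delta q))).
    apply: gen_layer => //=; have [_ /(_ _ Sd)[ltd _ _]] := lad.
    by elim: (q) => //= n ->; rewrite ltd.
  have [u [e [uu uB e0 xE]]] := (ZspanP _ _).1 (Cd _ lx).
  pose w := undup (s ++ t ++ u).
  have uw : uniq w by exact: undup_uniq.
  have wB : [set` w] `<=` B.
    by move=> h /=; rewrite mem_undup !mem_cat => /or3P[/sB|/tB|/uB[]].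
  have wE : \sum_(h <- w) h *~ (a h - e h - c h * q%:Z) = 0.
    have /eqP := gen_relation eta Sd q_prime; rewrite -subr_eq0 opprD addrA yE xE zE => /eqP rel.
    rewrite -[RHS]rel.
    rewrite (Zsum_widen us uw) // ?(Zsum_widen uu uw) // ?(Zsum_widen ut uw) //.
    - rewrite -sumrMnl -!sumrB; apply: eq_bigr => h _.
      by rewrite !mulrzBr mulrzA.
    - by move=> h hh; rewrite mem_undup !mem_cat hh ?orbT.
    - by move=> h hh; rewrite mem_undup !mem_cat hh ?orbT.
    - by move=> h hh; rewrite mem_undup !mem_cat hh ?orbT.
  have bw : b \in w by rewrite mem_undup mem_cat bs.
  (* x_s has coefficient 0 at [b], being spanned by basis elements inside [layer delta]. *)
  have /eqP := iB _ _ uw wB wE b bw; rewrite e0 ?subr0 ?subr_eq0 => [/eqP ->|].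
    exact: dvdz_mull.
  by apply/negP => /uB[].
have a_eq0 b : b \in s -> ~ layer delta b -> a b = 0.
  move=> bs nb; have [q q_gt q_prime] := prime_above `|a b|%N.
  have := a_dvd b q bs nb q_prime; rewrite dvdzE /= => dv; apply/eqP; rewrite -absz_eq0.
  by apply: contraTT dv; rewrite -lt0n => ab; rewrite gtnNdvd.
apply: (gen_notin_layer Sd); rewrite yE; apply: subgroup_sum => [|b bs].
  exact: subgroup_layer.
have [lb|nb] := pselect (layer delta b).
  exact: subgroupMz (subgroup_layer _) _.
by rewrite a_eq0 // mulr0z; exact: (subgroup0 (subgroup_layer _)).
Qed.

End Basis.

Lemma ladder_group_not_free : stationary S -> ladder_system S eta ->
  ~ free_abelian [set: G].
Proof.
move=> stS lad [B basisB].
have [delta [Sd Cd]] := stS _ (club_closed_layers basisB).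
exact: (closed_layer_notin basisB lad Sd Cd).
Qed.

End Layers.

Theorem theorem5 (d : Order.disp_t) (W : orderType d) (hW : is_omega1 W) :
  (exists (S : set W) (eta : W -> nat -> W),
     [/\ stationary S, ladder_system S eta &
         monochromatic_uniformization S eta]) ->
  exists G : zmodType,
    [/\ [set: G] #= [set: W],
        hereditarily_separable [set: G] &
        ~ free_abelian [set: G]].
Proof.
move=> [S [eta [stS lad unif]]]; exists (ladder_group S eta); split.
- exact: ladder_group_card.
- apply: hereditarily_separable_criterion.
    by move=> h h0; exact: ladder_enough_functionals.
  by move=> B b sB Bb bp; exact: ladder_unit_functional.
- exact: ladder_group_not_free.
Qed.
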